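(* Let $m\in(2-n,\infty)$, $0\le r_1<r_3\le\infty$, $u\in H^1(B_{r_3})$ (with $u\in H^1_{loc}(\mathbb{R}^n)$ if $r_3=\infty$), constants $\Lambda_\pm\ge0$, $\alpha,c_E,\epsilon\in(0,1]$, $\gamma\in[0,1)$, and an energy functional $\mathcal{E}:H^1(B_1)\to[-1,1]$ be such that: (1) $r\mapsto\mathcal{E}(u_r)$ is a $BV_{loc}$ function on $(r_1,r_3)$, and satisfies $$\frac{d}{dr}\mathcal{E}(u_r)\ge\frac{c_E}{r}\big(\mathcal{E}(z_r)-\mathcal{E}(u_r)\big)+\frac{c_E}{r}\int_{\partial B_1}r^2|\partial_ru_r|^2\,d\mathcal{H}^{n-1}-\Lambda_+r^{\alpha-1}-\Lambda_-r^{-\alpha-1}\quad\text{for a.e. }r\in(r_1,r_3);$$ (2) for a.e. $r\in(r_1,r_3)$, $$\mathcal{E}(u_r)\le\mathcal{E}(z_r)-\epsilon|\mathcal{E}(z_r)|^{1+\gamma}+\Lambda_+r^\alpha+\Lambda_-r^{-\alpha}.$$ Suppose $\max\{\Lambda_+r_3^\alpha,\Lambda_-r_1^{-\alpha}\}\le1$, and define $$G(r)=\mathcal{E}(u_r)+3\alpha^{-1}\Lambda_+r^\alpha-3\alpha^{-1}\Lambda_-r^{-\alpha}.$$ Then there are constants $\delta>0$ and $c$ depending only on $(c_E,\epsilon,\gamma,\alpha)$ such that: (1) $G$ is increasing, and for a.e. $r\in(r_1,r_3)$ satisfies $G'\ge(\delta/r)|G|^{1+\gamma}$. (2) The Dini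 estimate holds: $$\int_{r_1}^{r_3}\|r\,\partial_ru_r\|_{L^2(\partial B_1)}\frac{dr}{r}\le c\Big([G(r_1)_-]^{\frac{1-\gamma}{2}}+[G(r_3)_+]^{\frac{1-\gamma}{2}}\Big).$$ (3) If $r_2\in[r_1,r_3]$ is chosen so that $G\le0$ on $[r_1,r_2]$ and $G\ge0$ on $[r_2,r_3]$, then for any $r_2\le s\le r\le r_3$, $$\int_s^r\|\partial_ru_r\|_{L^2(\partial B_1)}\,dr\le\begin{cases}c\,\big(G(r_3)^{-\gamma}+\delta\gamma\log(r_3/r)\big)^{\frac{\gamma-1}{2\gamma}}&\gamma>0\\ c\,G(r_3)^{\frac12}(r/r_3)^{\frac{\delta}{2}}&\gamma=0,\end{cases}$$ while for any $r_1\le s\le r\le r_2$, $$\int_s^r\|\partial_ru_r\|_{L^2(\partial B_1)}\,dr\le\begin{cases}c\,\big((-G(r_1))^{-\gamma}+\delta\gamma\log(s/r_1)\big)^{\frac{\gamma-1}{2\gamma}}&\gamma>0\\ c\,(-G(r_1))^{\frac12}(r_1/s)^{\frac{\delta}{2}}&\gamma=0.\end{cases}$$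
   Context: $B_r$ is the ball of radius $r$ about $0$ in $\mathbb{R}^n$. For $r\le r_3$, $u_r(x)=r^{-m}u(rx)\in H^1(B_1)$ is the $m$-homogeneous rescaling; for a.e. $r\in(0,r_3)$, $z_r(x)=|x|^mu_r(x/|x|)\in H^1(B_1)$ is the $m$-homogeneous extension of $u_r|_{\partial B_1}$ to $B_1$. On $\partial B_1$, $\partial_ru_r(\theta)=\frac{d}{dr}\big(r^{-m}u(r\theta)\big)$. $\mathcal{H}^{n-1}$ is $(n-1)$-dimensional Hausdorff measure. $v_+=\max\{v,0\}$, $v_-=-\min\{v,0\}$. Conventions: if $r_1=0$ then $\Lambda_-=0$ and $G(r_1)$ means the limit of $G(r)$ as $r\to0$; if $r_3=\infty$ then $\Lambda_+=0$ and $G(r_3)$ means the limit of $G(r)$ as $r\to\infty$; $0^{-\gamma}=\infty$ and $\infty$ to a negative power is $0$.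
   Formalization: In (1) the derivative of the BV function is taken as a measure: besides the a.e. inequality its singular part is assumed nonnegative (else G can jump down); G(r_1), G(r_3) always mean one-sided limits of G, since the end-point values of the energy are unconstrained. *)

(* Defs.v *)
From HB Require Import structures.
From mathcomp Require Import all_boot all_order all_algebra.
From mathcomp Require Import all_classical all_reals all_analysis.
Set Implicit Arguments.
Unset Strict Implicit.
Unset Printing Implicit Defensive.
Import Order.TTheory GRing.Theory Num.Theory.
Import numFieldNormedType.Exports.
Local Open Scope classical_set_scope.
Local Open Scope ring_scope.

Section euclidean.
Variables (R : realType) (n : nat).
Implicit Types (x : 'rV[R]_n) (r : R) (f : 'rV[R]_n -> R).

(* The library norm on ['rV[R]_n] is the sup norm; the balls, spheres and
   diameters below are the Euclidean ones. *)
Definition enorm x : R := Num.sqrt (\sum_i x 0 i ^+ 2).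

Definition eball r : set 'rV[R]_n := [set x | enorm x < r].

Definition unit_sphere : set 'rV[R]_n := [set x | enorm x = 1].

(* ['rV[R]_n] with its Borel sigma-algebra; the carrier is unchanged. *)
Definition borelRn := g_sigma_algebraType (@open 'rV[R]_n).

Definition box (ab : 'rV[R]_n * 'rV[R]_n) : set 'rV[R]_n :=
  [set x | forall i, ab.1 0 i <= x 0 i <= ab.2 0 i].

(* Covers are indexed by an arbitrary set of naturals, so that finite covers
   are allowed (a degenerate box has volume 1 when n = 0). *)
Definition lebesgueRn (A : set borelRn) : \bar R :=
  ereal_inf [set s | exists (D : set nat) (F : nat -> 'rV[R]_n * 'rV[R]_n),
    [/\ forall k, D k -> forall i, (F k).1 0 i <= (F k).2 0 i,
        A `<=` \bigcup_(k in D) box (F k) &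
        s = (\esum_(k in D) (\prod_i ((F k).2 0 i - (F k).1 0 i))%:E)%E]].

Definition ediam (A : set 'rV[R]_n) : \bar R :=
  ereal_sup [set d | d = 0%E \/
    exists x y, [/\ A x, A y & d = (enorm (x - y))%:E]].

End euclidean.

(* [k]-dimensional Hausdorff measure on R^n, normalised by the volume of the
   unit ball of R^k so that it agrees with surface measure. *)
Section hausdorff.
Variables (R : realType) (n k : nat).

Definition hausdorff_pre (d : R) (A : set 'rV[R]_n) : \bar R :=
  ereal_inf [set s | exists (D : set nat) (F : nat -> set 'rV[R]_n),
    [/\ forall j, D j -> (ediam (F j) <= d%:E)%E,
        A `<=` \bigcup_(j in D) F j &
        s = (\esum_(j in D)
               (lebesgueRn (@eball R k 1) * ((2^-1)%:E * ediam (F j)) ^+ k))%E]].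

Definition hausdorff_measure (A : set (borelRn R n)) : \bar R :=
  ereal_sup [set hausdorff_pre d A | d in [set d : R | 0 < d]].

End hausdorff.

Section sobolev.
Variables (R : realType).

Definition smooth (V : normedModType R) (phi : V -> R) : Prop :=
  forall s : seq V,
    let f := foldr (fun v g => fun x => 'D_v g x) phi s in
    continuous f /\ forall v x, derivable f x v.

Definition test_function (V : normedModType R) (Om : set V) (phi : V -> R) :=
  smooth phi /\ exists K, [/\ compact K, K `<=` Om &
                              forall x, ~ K x -> phi x = 0].

Variable n : nat.

Definition L2 (Om : set 'rV[R]_n) (f : 'rV[R]_n -> R) : Prop :=
  measurable_fun (Om : set (borelRn R n)) (f : borelRn R n -> R) /\
  (\int[@lebesgueRn R n]_(x in Om) (f x ^+ 2)%:E < +oo)%E.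

Definition weak_gradient (Om : set 'rV[R]_n) (u : 'rV[R]_n -> R)
    (g : 'rV[R]_n -> 'rV[R]_n) : Prop :=
  forall phi, test_function Om phi -> forall i,
    (\int[@lebesgueRn R n]_(x in Om) (u x * 'D_(delta_mx 0 i) phi x)%:E =
     - \int[@lebesgueRn R n]_(x in Om) (g x 0 i * phi x)%:E)%E.

Definition H1 (Om : set 'rV[R]_n) (u : 'rV[R]_n -> R) : Prop :=
  L2 Om u /\
  exists g, weak_gradient Om u g /\ forall i, L2 Om (fun x => g x 0 i).

(* Elements are functions rather than classes: a functional on [H1_unit] has to
   be required to respect almost everywhere equality, see [ae_invariant]. *)
Definition H1_unit := {v : 'rV[R]_n -> R | H1 (@eball R n 1) v}.

Definition ae_invariant (E : H1_unit -> R) : Prop :=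
  forall v w : H1_unit,
    lebesgueRn [set x : borelRn R n | enorm x < 1 /\ sval v x != sval w x] = 0%E ->
    E v = E w.

(* Evaluation of [E] at a function; the value 0 is used off H^1(B_1). *)
Definition energy (E : H1_unit -> R) (v : 'rV[R]_n -> R) : R :=
  if pselect (H1 (@eball R n 1) v) is left h then E (exist _ v h) else 0.

Definition rescale (m : R) (u : 'rV[R]_n -> R) (r : R) : 'rV[R]_n -> R :=
  fun x => r `^ (- m) * u (r *: x).

Definition homog_ext (m : R) (u : 'rV[R]_n -> R) (r : R) : 'rV[R]_n -> R :=
  fun x => enorm x `^ m * rescale m u r ((enorm x)^-1 *: x).

End sobolev.

Section rays.
Variable R : realType.
Local Notation mu := (@lebesgue_measure R).

Definition oitv (a b : \bar R) : set R := [set t | (a < t%:E < b)%E].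

Definition loc_integrable (I : set R) (f : R -> R) : Prop :=
  forall a b, `[a, b] `<=` I -> mu.-integrable `[a, b] (EFin \o f).

Definition weak_derivative (I : set R) (f g : R -> R) : Prop :=
  [/\ loc_integrable I f, loc_integrable I g &
      forall phi : R -> R, @test_function R R^o I phi ->
        (\int[mu]_(t in I) (f t * derive1 phi t)%:E =
         - \int[mu]_(t in I) (g t * phi t)%:E)%E].

Variable n : nat.

Definition surface : set (borelRn R n) -> \bar R :=
  @hausdorff_measure R n n.-1.

(* [w r theta] is d/dr (r^-m u(r theta)), taken in the weak sense along almost
   every ray since [u] is only an H^1 function. *)
Definition radial_derivative (m : R) (r3 : \bar R) (u : 'rV[R]_n -> R)
    (w : R -> 'rV[R]_n -> R) : Prop :=
  measurable_fun (oitv 0 r3 `*` (@unit_sphere R n : set (borelRn R n)))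
    (fun p : R * borelRn R n => w p.1 p.2) /\
  surface [set th | enorm th = 1 /\
    ~ weak_derivative (oitv 0 r3) (fun r => rescale m u r th) (w ^~ th)] = 0%E.

Definition L2_sphere (f : 'rV[R]_n -> R) : \bar R :=
  ((\int[surface]_(th in @unit_sphere R n) (f th ^+ 2)%:E) `^ 2^-1)%E.

End rays.

Section bounded_variation.
Variable R : realType.
Local Notation mu := (@lebesgue_measure R).

Definition BV_loc (a b : \bar R) (e : R -> R) : Prop :=
  forall s t, s <= t -> `[s, t] `<=` oitv a b -> bounded_variation s t e.

(* For e in BV_loc the derivative is a measure De = e' dr + D^s e, where e' is
   the pointwise derivative, which exists a.e.  The inequality De >= f dr
   means: e' >= f a.e., and the singular part of De is nonnegative, i.e.
   De >= e' dr. *)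
Definition BV_derivative_ge (a b : \bar R) (e : R -> R) (f : R -> \bar R) : Prop :=
  {ae mu, forall r, oitv a b r ->
     derivable e r 1 /\ (f r <= (derive1 e r)%:E)%E} /\
  (forall s t, s < t -> `[s, t] `<=` oitv a b ->
     (\int[mu]_(r in `[s, t]) (derive1 e r)%:E <= (e t - e s)%:E)%E).

End bounded_variation.

Section bounds.
Variable R : realType.

(* [G] on the closed interval [a, b], with its one-sided limits as values at
   the end points. *)
Definition extend_to_ends (a : R) (b : \bar R) (G : R -> R) (x : \bar R) : R :=
  if (x <= a%:E)%E then lim (G t @[t --> a^'+])
  else if (b <= x)%E then
    (if b is b'%:E then lim (G t @[t --> b'^'-]) else lim (G t @[t --> +oo]))
  else G (fine x).

(* The library powers satisfy 0 `^ p = 0 and +oo `^ p = +oo for p < 0; here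
   they are +oo and 0. *)
Definition epow (x : \bar R) (p : R) : \bar R :=
  if p < 0 then
    (if x is y%:E then if y == 0 then +oo%E else (y `^ p)%:E else 0%E)
  else (x `^ p)%E.

(* a / b, read as 0 when b = +oo or a = 0 (including oo/oo and 0/0). *)
Definition equot (a b : \bar R) : R := if b is b'%:E then fine a / b' else 0.

(* log(b / a), with value +oo when [equot a b = 0]. *)
Definition log_ratio (b a : \bar R) : \bar R := (- lne (equot a b)%:E)%E.

End bounds.

(* Main.v *)
Require Import Defs.
From HB Require Import structures.
From mathcomp Require Import all_boot all_order all_algebra.
From mathcomp Require Import all_classical all_reals all_analysis measurable_realfun.
From mathcomp Require Import ring lra.
Import Order.TTheory GRing.Theory Num.Theory.
Import numFieldNormedType.Exports HBNNSimple.
Local Open Scope classical_set_scope.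
Local Open Scope ring_scope.

(* Adding the error terms to the energy makes both c_E ||r d_r u_r||^2 and
   delta |G|^(1+gamma) at most r G'.  The geometric mean of these two bounds is
   ||d_r u_r|| <= C (d/dr) (sgn(G) |G|^((1-gamma)/2)), and the integral of the
   derivative of a monotone function is at most its total increment, which gives
   the length estimates.  The decay rates come from applying the same fact to
   -G^(-gamma) or log G where G > 0, and to (-G)^(-gamma) or -log(-G) where
   G < 0: the derivatives of these functions are at least delta gamma / r,
   respectively delta / r. *)

(** * Derivatives of monotone functions *)

(** [G] has only locally bounded variation: it may jump or have a Cantor part, so its increments are
    not integrals of [G'], and only one-sided inequalities are available. In particular [G' >= 0]
    almost everywhere does not make [G] increasing; the sign of the singular part of the derivative
    of the energy enters as well. A second obstacle is measurability: the speed [L2_sphere (dru r)]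
    is never shown to be measurable in [r], so it is only compared almost everywhere with a
    measurable majorant. The correction terms in [G] have as derivative three times the error in the
    inequality for the energy. One multiple cancels that error, one pays for the error in the
    comparison of [u_r] with [z_r], and one is left over, so that the error itself is at most
    [r G']. The bounds by 1 on the energies and on each error term then turn the power [1 + gamma]
    of what separates [G] from [E(z_r)] into a multiple of its first power. *)

(* The integral of [f] is a supremum over the measurable simple functions below
   it, and each of these is almost everywhere at most [g]. *)
Lemma ge0_le_integral_ae d (T : measurableType d) (R : realType)
    (mu : {measure set T -> \bar R}) (D : set T) (f g : T -> \bar R) :
  measurable D -> (forall x, D x -> 0 <= f x)%E ->
  measurable_fun D g -> (forall x, D x -> 0 <= g x)%E ->
  {ae mu, forall x, D x -> (f x <= g x)%E} ->
  (\int[mu]_(x in D) f x <= \int[mu]_(x in D) g x)%E.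
Proof.
move=> mD f0 mg g0 fg; rewrite [leLHS]ge0_integralE//.
apply: ge_ereal_sup => _ [h /= hf <-].
have hD : h \_ D = h.
  apply/funext => x; rewrite patchE; case: ifPn => // /negP xD.
  have := hf x; rewrite patchE memNset//; last by move=> ?; apply: xD; rewrite inE.
  by rewrite lee_fin => hx0; apply/esym/eqP; rewrite eq_le hx0 fun_ge0.
rewrite -hD -integral_nnsfun//.
apply: ae_ge0_le_integral => //.
- by move=> x _; rewrite lee_fin fun_ge0.
- exact/measurable_EFinP/measurable_funTS.
- apply: filterS fg => x + Dx => /(_ Dx); apply: le_trans.
  by have := hf x; rewrite patchE mem_set.
Qed.

(** The pushforward of Lebesgue measure under the translation gives every half-open interval its
    length, hence is Lebesgue measure by uniqueness. *)
Lemma ge0_integral_translation (R : realType) (h : R) (D : set R) (f : R -> \bar R) :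
  measurable D -> measurable_fun D f -> (forall x, 0 <= f x)%E ->
  (\int[@lebesgue_measure R]_(x in [set x : R | D (x + h)%R]) f (x + h)%R
   = \int[@lebesgue_measure R]_(x in D) f x)%E.
Proof.
move=> mD mf f0.
pose tau : R -> measurableTypeR R := fun x => x + h.
have mtau : measurable_fun setT tau by exact: measurable_funD.
rewrite -[LHS]/(\int[lebesgue_measure]_(x in tau @^-1` D) (f \o tau) x)%E.
rewrite -ge0_integral_pushforward//.
apply: eq_measure_integral => A mA AD.
pose mtau_mixin := isMeasurableFun.Build _ _ _ _ _ mtau.
pose mtau_pack : {mfun _ >-> _} := HB.pack tau mtau_mixin.
apply/esym; apply: (@lebesgue_measure_unique R
  (pushforward (@lebesgue_measure R) mtau_pack)) => // _ [[a b] _ <-].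
apply: (@etrans _ _ (lebesgue_measure `]a - h, b - h]%classic)).
  rewrite !lebesgue_measure_itv/= !lte_fin ltrD2r.
  by rewrite -!EFinB opprD addrACA opprK addNr addr0.
rewrite /pushforward; congr (lebesgue_measure _).
by apply/seteqP; split => x /=; rewrite !in_itv/= lerBrDr ltrBlDr.
Qed.

(** Shifting the window of integration by [h] adds at most the integral of [H] over an interval of
    length [h], which is at most [h * M]. The bound depends neither on [h] nor on [N], so both
    limits can be taken later. *)
Lemma integral_translation_quotient_le (R : realType) (H : R -> R) (M N h : R) :
  {homo H : x y / x <= y} -> (forall x, 0 <= H x <= M) -> 0 <= N -> 0 < h ->
  (\int[@lebesgue_measure R]_(x in `[(- N)%R, N])
     (h^-1 * (H (x + h) - H x))%R%:E <= M%:E)%E.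
Proof.
move=> ndH H0M N0 h0.
have mH D : measurable D -> measurable_fun (D : set R) (EFin \o H).
  by move=> mD; apply/measurable_EFinP; exact: nondecreasing_measurable.
have mHh : measurable_fun setT (fun x : R => H (x + h)).
  by apply: nondecreasing_measurable => // x y xy; rewrite ndH// lerD2r.
have H0 x : 0 <= H x by have /andP[] := H0M x.
have HM x : H x <= M by have /andP[] := H0M x.
have D0 x : 0 <= H (x + h) - H x by rewrite subr_ge0 ndH// lerDl ltW.
have fin a b : a <= b -> (\int[@lebesgue_measure R]_(x in `[a, b]) (H x)%:E)%E \is a fin_num.
  move=> ab; rewrite ge0_fin_numE; last by apply: integral_ge0 => x _; rewrite lee_fin.
  apply: (@le_lt_trans _ _ (\int[@lebesgue_measure R]_(x in `[a, b]) M%:E)%E).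
    apply: ge0_le_integral => //; rewrite ?lee_fin//.
    - by move=> x _; rewrite lee_fin.
    - exact: mH.
    - by move=> x _; rewrite lee_fin.
  by rewrite integral_cst//= lebesgue_measure_itv/=; case: ifP => _;
    rewrite ?mule0// -EFinB -EFinM ltry.
pose I := (\int[@lebesgue_measure R]_(x in `[(- N)%R, N]) (H (x + h) - H x)%R%:E)%E.
have NN : - N <= N by rewrite (le_trans _ N0)// oppr_le0.
(* The integral of [H] is added on both sides to avoid a subtraction in the extended reals; it is
   finite by [fin] and cancelled in [le2]. *)
have le1 : (I + \int[@lebesgue_measure R]_(x in `[(- N)%R, N]) (H x)%:E <=
    (h * M)%:E + \int[@lebesgue_measure R]_(x in `[(- N)%R, N]) (H x)%:E)%E.
  rewrite /I -ge0_integralD//=; last 4 first.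
  - by move=> x _; rewrite lee_fin.
  - apply/measurable_EFinP/measurable_funB => //.
      exact: measurable_funTS.
    exact: nondecreasing_measurable.
  - by move=> x _; rewrite lee_fin.
  - exact: mH.
  under eq_integral do rewrite -EFinD subrK.
  have := @ge0_integral_translation R h `[(- N + h), (N + h)]%classic (EFin \o H).
  have -> : [set x : R | `[(- N + h), (N + h)]%classic (x + h)] = `[(- N)%R, N]%classic.
    by apply/seteqP; split => x /=; rewrite !in_itv/= !lerD2r.
  move=> -> //; last exact: mH.
  have NhM : (\int[lebesgue_measure]_(x in `]N, (N + h)%R]) (H x)%:E <= (h * M)%:E)%E.
    apply: (@le_trans _ _ (\int[@lebesgue_measure R]_(x in `]N, (N + h)%R]) M%:E)%E).
      apply: ge0_le_integral => //.
      - by move=> x _; rewrite lee_fin.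
      - exact: mH.
      - by move=> x _; rewrite lee_fin.
    rewrite integral_cst//= lebesgue_measure_itv/= lte_fin ltrDl h0.
    by rewrite -EFinB -EFinM addrAC subrr add0r mulrC.
  apply: le_trans (leeD2r _ NhM).
  rewrite -ge0_integral_setU//; last 3 first.
  - by apply: mH; exact: measurableU.
  - by move=> x _; rewrite lee_fin.
  - rewrite disj_set2E; apply/eqP/seteqP; split => x //= -[].
    by rewrite !in_itv/= => /andP[Nx _] /andP[_ /(lt_le_trans Nx)]; rewrite ltxx.
  apply: ge0_subset_integral => //.
  - exact: measurableU.
  - by apply: mH; exact: measurableU.
  - by move=> x _; rewrite lee_fin.
  - move=> x /=; rewrite !in_itv/= => /andP[a b].
    case: (leP x N) => xN; [right|left]; rewrite ?b ?ltW//.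
    by rewrite (lt_le_trans _ a)// ltrDl.
have le2 : (I <= (h * M)%:E)%E by move: le1; rewrite leeD2rE// fin.
under eq_integral do rewrite EFinM.
rewrite ge0_integralZl//=; last 3 first.
- apply/measurable_EFinP/measurable_funB => //.
    exact: measurable_funTS.
  exact: nondecreasing_measurable.
- by move=> x _; rewrite lee_fin.
- by rewrite lee_fin invr_ge0 ltW.
apply: (le_trans (lee_wpmul2l _ le2)); first by rewrite lee_fin invr_ge0 ltW.
by rewrite -EFinM lee_fin mulKf// gt_eqF.
Qed.

Lemma derivable_harmonic_cvg (R : realType) (H : R -> R) (x : R) :
  derivable H x 1 ->
  (harmonic n)^-1 * (H (x + harmonic n) - H x) @[n --> \oo] --> derive1 H x.
Proof.
rewrite derive1E => dH.
pose d h := h^-1 *: ((H \o shift x) (h *: 1%R) - H x).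
have dl : d h @[h --> 0^'] --> 'D_1 H x by [].
rewrite (_ : (fun n => _) = d \o harmonic).
  by move/cvgr_dnbhsP : dl; apply; split; [move=> n; rewrite gt_eqF// harmonic_gt0|exact: cvg_harmonic].
by apply/funext => n /=; rewrite /d /= [_%:A]mulr1 (addrC x).
Qed.

(* [g] is the lower limit of the difference quotients of step 1/(n+1), to which
   Fatou's lemma applies. *)
Lemma derive1_majorant (R : realType) (H : R -> R) (M : R) :
  {homo H : x y / x <= y} -> (forall x, 0 <= H x <= M) ->
  exists g : R -> \bar R,
    [/\ measurable_fun setT g, forall x, (0 <= g x)%E,
        forall x, derivable H x 1 -> g x = (derive1 H x)%:E &
        (\int[@lebesgue_measure R]_x g x <= M%:E)%E].
Proof.
move=> ndH H0M.
pose q n x : \bar R := (((harmonic n)^-1 : R) * (H (x + harmonic n) - H x))%:E.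
have q0 n x : (0 <= q n x)%E.
  by rewrite lee_fin mulr_ge0 ?invr_ge0 ?harmonic_ge0// subr_ge0 ndH// lerDl harmonic_ge0.
have mq n : measurable_fun setT (q n).
  apply/measurable_EFinP/measurable_funM => //; apply: measurable_funB.
    by apply: nondecreasing_measurable => // x y xy; rewrite ndH// lerD2r.
  exact: nondecreasing_measurable.
pose g x := limn_einf (q ^~ x).
have mg : measurable_fun setT g.
  rewrite (_ : g = fun x => - limn_esup (fun n => - q n x))%E.
    apply: measurableT_comp => //; apply: measurable_fun_limn_esup => n.
    exact: measurableT_comp.
  by [].

have g0 x : (0 <= g x)%E.
  rewrite /g limn_einf_lim; apply: lime_ge; first exact: is_cvg_einfs.
  by apply: nearW => n; apply: le_ereal_inf_tmp => _ [m _ <-].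
exists g; split => //.
  move=> x dH; have := derivable_harmonic_cvg _ _ _ dH.
  move=> cvg_dH; rewrite /g; have [//|-> _ //] := @cvg_limn_einf_sup _ (q ^~ x) (derive1 H x)%:E.
  by apply: cvg_EFin; [exact: nearW|exact: cvg_dH].
(* The bound on difference quotients concerns bounded windows, so the line is exhausted by [F n];
   Fatou is applied on each of them. *)
pose F n : set R := `[- n%:R, n%:R]%classic.
have FT : \bigcup_n F n = setT.
  apply/seteqP; split => // x _.
  exists (Num.trunc `|x|).+1 => //; rewrite /F/= in_itv/= -ler_norml.
  by rewrite ltW// truncnS_gt.
rewrite -FT.
have mgF n : measurable_fun (F n) g by exact: measurable_funTS.
have ndF : nondecreasing_seq F.
  apply/nondecreasing_seqP => n; rewrite subsetEset; apply: subset_itv;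
    by rewrite bnd_simp ?lerN2 ler_nat.
have cvF : (\int[@lebesgue_measure R]_(x in F i) g x)%E @[i --> \oo] -->
    (\int[@lebesgue_measure R]_(x in \bigcup_i F i) g x)%E.
  by apply: ge0_nondecreasing_set_cvg_integral => // i; exact: measurable_itv.
rewrite -(cvg_lim _ cvF)//; apply: lime_le; first by apply/cvg_ex; eexists; exact: cvF.
apply: nearW => n.
apply: (le_trans (fatou _ _ _ _)) => //.
- exact: measurable_itv.
- by move=> k; exact: (measurable_funTS (mq k)).
rewrite limn_einf_lim; apply: lime_le; first exact: is_cvg_einfs.
apply: nearW => k; apply: ge_ereal_inf.
exists (\int[lebesgue_measure]_(x in F n) q k x)%E; first by exists k => /=.
by apply: integral_translation_quotient_le => //; exact: harmonic_gt0.
Qed.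

Lemma ae_lebesgueW (R : realType) (P Q : R -> Prop) :
  (forall x, P x -> Q x) ->
  {ae @lebesgue_measure R, forall x, P x} -> {ae @lebesgue_measure R, forall x, Q x}.
Proof. by move=> PQ; apply: filterS PQ; exact: (ae_filter_ringOfSetsType lebesgue_measure). Qed.

Lemma ae_lebesgueW2 (R : realType) (P1 P2 Q : R -> Prop) :
  (forall x, P1 x -> P2 x -> Q x) ->
  {ae @lebesgue_measure R, forall x, P1 x} ->
  {ae @lebesgue_measure R, forall x, P2 x} -> {ae @lebesgue_measure R, forall x, Q x}.
Proof.
by move=> PQ; apply: filterS2 PQ; exact: (ae_filter_ringOfSetsType lebesgue_measure).
Qed.

Lemma open_oitv (R : realType) (a b : \bar R) : open (oitv a b).
Proof.
rewrite (_ : oitv a b = [set t | a < t%:E]%E `&` [set t | t%:E < b]%E).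
  by apply: openI; [exact: open_ereal_gt|exact: open_ereal_lt].
by apply/seteqP; split => t /=; rewrite /oitv/= => /andP.
Qed.

(* The [F x <= 0] alternative allows for points where [H] has no derivative. *)
Lemma integral_derive1_nondecreasing (R : realType) (a b : \bar R) (H : R -> R)
    (A B : R) (F : R -> \bar R) :
  A <= B ->
  (forall x y, oitv a b x -> oitv a b y -> x <= y -> H x <= H y) ->
  (forall x, oitv a b x -> A <= H x <= B) ->
  (forall x, oitv a b x -> 0 <= F x)%E ->
  {ae @lebesgue_measure R, forall x, oitv a b x -> (F x <= 0)%E \/
    (derivable H x 1 /\ (F x <= (derive1 H x)%:E)%E)} ->
  (\int[@lebesgue_measure R]_(x in oitv a b) F x <= (B - A)%:E)%E.
Proof.
move=> AB ndH HAB F0 FH.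
(* Extending [H - A] by 0 on the left and by [B - A] on the right gives a monotone bounded function
   on the whole line, with the same derivative inside the interval. *)
pose K x := if (x%:E <= a)%E then 0 else if (x%:E < b)%E then H x - A else B - A.
have KE x : oitv a b x -> K x = H x - A.
  by move=> /andP[ax xb]; rewrite /K leNgt ax/= xb.
have K0 x : 0 <= K x <= B - A.
  rewrite /K; have [_|ax] := leP x%:E a; first by rewrite lexx subr_ge0.
  have [xb|_] := ltP x%:E b; last by rewrite lexx subr_ge0 AB.
  by rewrite subr_ge0 lerD2r HAB// /oitv/= ax.
have ndK : {homo K : x y / x <= y}.
  move=> x y xy; have /andP[Ky0 _] := K0 y; have /andP[_ KxM] := K0 x.
  have [xa|ax] := leP x%:E a; first by rewrite {1}/K xa.
  have ay : (a < y%:E)%E by rewrite (lt_le_trans ax)// lee_fin.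
  have [yb|b_le_y] := ltP y%:E b; last by rewrite [K y]/K (leNgt y%:E) ay/= (ltNge y%:E) b_le_y.
  have xb : (x%:E < b)%E by rewrite (le_lt_trans _ yb)// lee_fin.
  by rewrite !KE ?lerD2r ?ndH// /oitv/= ?ax ?ay.
have [g [mg g0 gK intg]] := derive1_majorant _ _ _ ndK K0.
have moitv : measurable (oitv a b) by apply: open_measurable; exact: open_oitv.
apply: (@le_trans _ _ (\int[lebesgue_measure]_(x in oitv a b) g x)%E).
  apply: ge0_le_integral_ae => //.
    exact: measurable_funTS.
  apply: ae_lebesgueW FH => x FHx abx; have [Fx0|[dH FdH]] := FHx abx.
    exact: le_trans (g0 x).
  have nearK : \near x, (H - cst A) x = K x.
    have := open_nbhs_nbhs (conj (open_oitv _ a b) abx).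
    by apply: filterS => y /KE ->.
  have dHA : derivable (H - cst A) x 1 by exact: (derivableB dH (derivable_cst A x 1)).
  rewrite gK; last exact: near_eq_derivable dHA.
  rewrite (le_trans FdH)// lee_fin !derive1E -(near_eq_derive _ nearK).
  by rewrite (deriveB dH (derivable_cst A x 1)) derive_cst subr0.
apply: le_trans intg; apply: ge0_subset_integral => //.
Qed.

(** * Integrals against the Hausdorff measure *)

(* [m] is a mere set function because it will be the Hausdorff measure, whose
   additivity on Borel sets is not available. *)
Lemma sintegral_scale d (T : sigmaRingType d) (R : realType)
    (m : set T -> \bar R) (k : R) (h : {nnsfun T >-> R}) :
  m set0 = 0%E -> (forall A, 0 <= m A)%E -> k != 0 ->
  sintegral m (fun x => k * h x) = (k%:E * sintegral m h)%E.
Proof.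
move=> m0 mge0 k0; rewrite !sintegralET ge0_mule_fsumr; last first.
  move=> x; have [x0|x0] := leP 0 x; first by rewrite mule_ge0// lee_fin.
  by rewrite preimage_nnfun0// m0 mule0.
rewrite (reindex_fsbigT ( *%R k))/=; last first.
  by exists ( *%R k^-1); [exact: mulKf|exact: mulVKf].
apply: eq_fsbigr => x _; rewrite EFinM -muleA; congr (_ * (_ * m _))%E.
apply/seteqP; split => t /= => [/(mulfI k0)//|-> //].
Qed.

Lemma sintegral_cst0 d (T : sigmaRingType d) (R : realType) (m : set T -> \bar R) :
  m set0 = 0%E -> sintegral m (cst (0 : R)) = 0%E.
Proof.
move=> m0; rewrite sintegralET fsbig1// => x _.
have [->|x0] := eqVneq x 0; first by rewrite mul0e.
rewrite (_ : _ @^-1` _ = set0) ?m0 ?mule0//.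
by apply/seteqP; split => // t /= /esym/eqP; rewrite (negbTE x0).
Qed.

(** The integral is by definition a difference of two suprema. For [f >= 0] the second runs over
    simple functions that vanish, whose integral is 0 as soon as [m set0 = 0]. *)
Lemma ge0_integral_setfunE d (T : measurableType d) (R : realType)
    (m : set T -> \bar R) (D : set T) (f : T -> \bar R) :
  m set0 = 0%E -> (forall x, D x -> 0 <= f x)%E ->
  (\int[m]_(x in D) f x)%E = ereal_sup [set sintegral m h | h in
    [set h : {nnsfun T >-> R} | forall x, ((h x)%:E <= (f \_ D) x)%E]].
Proof.
move=> m0 f0; rewrite /integral funeneg_restrict funepos_restrict.
have /eq_restrictP-> := ge0_funeposE f0.
have /eq_restrictP-> := ge0_funenegE f0.
rewrite erestrict0 [X in (_ - X)%E](_ : _ = 0%E) ?sube0//.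
apply/eqP; rewrite eq_le; apply/andP; split; last first.
  by apply: ereal_sup_ubound; exists nnsfun0 => //; exact: sintegral_cst0.
apply: ge_ereal_sup => _ [h /= h0 <-].
rewrite (eq_sintegral (cst 0)) ?sintegral_cst0// => x.
by apply/eqP; rewrite eq_le -2!lee_fin h0/= lee_fin.
Qed.

Lemma integral_setfun_ge0 d (T : measurableType d) (R : realType)
    (m : set T -> \bar R) (D : set T) (f : T -> \bar R) :
  m set0 = 0%E -> (forall x, D x -> 0 <= f x)%E ->
  (0 <= \int[m]_(x in D) f x)%E.
Proof.
move=> m0 f0; rewrite ge0_integral_setfunE//; apply: ereal_sup_ubound.
exists nnsfun0; last exact: sintegral_cst0.
by move=> x /=; rewrite patchE; case: ifPn => // /set_mem/f0.
Qed.

Lemma ge0_integral_scale_le d (T : measurableType d) (R : realType)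
    (m : set T -> \bar R) (D : set T) (k : R) (f : T -> \bar R) :
  m set0 = 0%E -> (forall A, 0 <= m A)%E -> 0 < k ->
  (forall x, D x -> 0 <= f x)%E ->
  (k%:E * \int[m]_(x in D) f x <= \int[m]_(x in D) (k%:E * f x))%E.
Proof.
move=> m0 mge0 k0 f0; rewrite !ge0_integral_setfunE//; last first.
  by move=> x Dx; rewrite mule_ge0 ?f0// lee_fin ltW.
rewrite -lee_pdivlMl//; apply: ge_ereal_sup => _ [h /= hf <-].
rewrite lee_pdivlMl// -sintegral_scale ?gt_eqF//.
apply: ereal_sup_ubound; exists (scale_nnsfun h (ltW k0)) => //= x.
move: (hf x); rewrite !patchE; case: ifPn => _ hfx.
  by rewrite EFinM lee_pmul2l// lte_fin.
(* Off [D] the restriction takes the default value [point], which is 0 and so is unchanged by the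
   factor [k]. *)
by rewrite EFinM -[point](mule0 k%:E) lee_pmul2l// lte_fin.
Qed.

Section hausdorff_measure_basics.
Variables (R : realType) (n k : nat).

Lemma lebesgueRn_ge0 m (A : set (borelRn R m)) : (0 <= lebesgueRn A)%E.
Proof.
apply: le_ereal_inf_tmp => _ [D [F [FD _ ->]]].
apply: esum_ge0 => j Dj; rewrite lee_fin; apply: prodr_ge0 => i _.
by rewrite subr_ge0 FD.
Qed.

Lemma ediam_ge0 (A : set 'rV[R]_n) : (0 <= ediam A)%E.
Proof. by apply: ereal_sup_ubound; left. Qed.

Lemma hausdorff_pre_ge0 d (A : set 'rV[R]_n) : (0 <= hausdorff_pre k d A)%E.
Proof.
apply: le_ereal_inf_tmp => _ [D [F [_ _ ->]]]; apply: esum_ge0 => j Dj.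
rewrite mule_ge0 ?lebesgueRn_ge0// expe_ge0// mule_ge0 ?ediam_ge0// lee_fin invr_ge0.
Qed.

Lemma hausdorff_measure_ge0 (A : set (borelRn R n)) : (0 <= hausdorff_measure k A)%E.
Proof.
apply: le_trans (hausdorff_pre_ge0 1 A) _.
by apply: ereal_sup_ubound; exists 1 => //=.
Qed.

(** The cover is the one with empty index set: for [k = 0] even an empty covering set would
    contribute a 0-th power, which is 1. *)
Lemma hausdorff_measure0 : @hausdorff_measure R n k set0 = 0%E.
Proof.
apply/eqP; rewrite eq_le hausdorff_measure_ge0 andbT.
apply: ge_ereal_sup => _ [d _ <-]; apply: ereal_inf_lbound.
by exists set0, (fun=> set0); split => //; rewrite esum_set0.
Qed.

End hausdorff_measure_basics.

Lemma L2_sphere_ge0 (R : realType) n (f : 'rV[R]_n -> R) : (0 <= L2_sphere f)%E.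
Proof. exact: poweR_ge0. Qed.

(** The energy inequality bounds the integral with [r ^+ 2] inside. Taking this factor out only in
    the direction of [ge0_integral_scale_le] is enough for an upper bound on the norm. *)
Lemma L2_sphere_le (R : realType) n (f : 'rV[R]_n -> R) (r M : R) :
  0 < r -> 0 <= M ->
  (\int[@surface R n]_(th in @unit_sphere R n) (r ^+ 2 * `|f th| ^+ 2)%:E
     <= M%:E)%E ->
  (L2_sphere f <= (r^-1 * Num.sqrt M)%:E)%E.
Proof.
move=> r0 M0 hM.
have r20 : 0 < r ^+ 2 by rewrite exprn_gt0.
have : (\int[@surface R n]_(th in @unit_sphere R n) (f th ^+ 2)%:E
    <= (r ^- 2 * M)%:E)%E.
  rewrite EFinM lee_pdivlMl//.
  apply: le_trans hM.
  apply: le_trans (ge0_integral_scale_le _ _ _ _ _ _ _ _ _ _ _) _ => //.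
  - exact: hausdorff_measure0.
  - exact: hausdorff_measure_ge0.
  - by move=> x _; rewrite lee_fin sqr_ge0.
  - rewrite (_ : (fun x => (r ^+ 2)%:E * _)%E = (fun x => (r ^+ 2 * `|f x| ^+ 2)%:E))//.
    by apply/funext => x; rewrite -EFinM real_normK ?num_real.
move=> h.
have M'0 : 0 <= r ^- 2 * M by rewrite mulr_ge0// invr_ge0 ltW.
have -> : (r^-1 * Num.sqrt M)%:E = ((r ^- 2 * M)%:E `^ 2^-1)%E.
  rewrite poweR_EFin powR12_sqrt// sqrtrM ?invr_ge0 ?ltW// -exprVn sqrtr_sqr.
  by rewrite ger0_norm// invr_ge0 ltW.
apply: gt0_ler_poweR => //.
- rewrite in_itv/= leey andbT integral_setfun_ge0//.
  + exact: hausdorff_measure0.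
  + by move=> x _; rewrite lee_fin sqr_ge0.
- by rewrite in_itv/= leey andbT lee_fin.
Qed.

Lemma L2_sphereM_le (R : realType) n (f : 'rV[R]_n -> R) (r M : R) :
  0 <= M ->
  (\int[@surface R n]_(th in @unit_sphere R n) (r ^+ 2 * `|f th| ^+ 2)%:E
     <= M%:E)%E ->
  (L2_sphere (fun th => r * f th)%R <= (Num.sqrt M)%:E)%E.
Proof.
(* With radius 1 and the function [r * f], the factor [r] stays inside the integral. *)
move=> M0 hM; have := @L2_sphere_le R n (fun th => r * f th) 1 M ltr01 M0.
rewrite invr1 mul1r; apply; apply: le_trans hM; rewrite le_eqVlt; apply/orP; left.
apply/eqP; congr (integral _ _ _); apply/funext => x.
by rewrite expr1n mul1r normrM exprMn real_normK ?num_real.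
Qed.

(** * The differential inequality *)

Lemma integral_is_derive (R : realType) (F f : R -> R) (a b : R) :
  a < b ->
  (forall x, a <= x <= b -> is_derive x 1 F (f x)) ->
  (forall x, a <= x <= b -> {for x, continuous f}) ->
  (\int[@lebesgue_measure R]_(x in `[a, b]) (f x)%:E = (F b - F a)%:E)%E.
Proof.
move=> ab dF cf; rewrite EFinB; apply: continuous_FTC2 => //.
- apply: continuous_in_subspaceT => x; rewrite inE/= in_itv/= => xab.
  exact: cf.
- have cF x : a <= x <= b -> {for x, continuous F}.
    by move=> xab; apply: differentiable_continuous; apply/derivable1_diffP;
      case: (dF x xab).
  split.
  + move=> x; rewrite in_itv/= => /andP[ax xb].
    by case: (dF x _) => //; rewrite !ltW.
  + by apply: cvg_at_right_filter; apply: cF; rewrite lexx ltW.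
  + by apply: cvg_at_left_filter; apply: cF; rewrite lexx ltW.
- move=> x; rewrite in_itv/= => /andP[ax xb]; rewrite derive1E.
  by case: (dF x _) => //; rewrite !ltW.
Qed.

Lemma integral_oo_is_derive (R : realType) (F f : R -> R) (a b : R) :
  a < b ->
  (forall x, a <= x <= b -> is_derive x 1 F (f x)) ->
  (forall x, a <= x <= b -> {for x, continuous f}) ->
  (\int[@lebesgue_measure R]_(x in oitv a%:E b%:E) (f x)%:E = (F b - F a)%:E)%E.
Proof.
move=> ab dF cf; rewrite -(integral_is_derive _ _ _ _ _ ab dF cf).
rewrite (_ : oitv _ _ = `]a, b[%classic); last first.
  by apply/seteqP; split => x /=; rewrite /oitv/= in_itv/= !lte_fin.
rewrite -(@integral_itv_bndoo R a b _ true false)//.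
apply/measurable_EFinP; apply: open_continuous_measurable_fun => // x.
by rewrite inE/= in_itv/= => /andP[ax xb]; apply: cf; rewrite !ltW.
Qed.

(** Otherwise a point of the interval beyond both [t] and [expR C] would violate the bound. This is
    how a decay estimate inside the interval rules out an infinite right end. *)
Lemma right_end_log_le (R : realType) (t C : R) (b : \bar R) :
  0 < t -> (t%:E < b)%E -> (forall x, t < x -> (x%:E < b)%E -> ln x <= C) ->
  exists2 b', b = b'%:E & ln b' <= C.
Proof.
move=> t0 tb lnC.
have xC x : t < x -> (x%:E < b)%E -> x <= expR C.
  by move=> tx xb; rewrite -[x]lnK ?posrE ?(lt_trans t0)// ler_expR lnC.
case: b tb {lnC} xC => [b| |]//= + xC; rewrite ?lte_fin => tb.
- exists b => //; rewrite -[C]expRK ler_ln ?posrE ?expR_gt0 ?(lt_trans t0)//.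
  rewrite leNgt; apply/negP => Cb.
  have mb : Num.max t (expR C) < b by rewrite gt_max tb.
  have := xC ((Num.max t (expR C) + b) / 2).
  have [m1 m2] := midf_lt mb.
  rewrite lte_fin m2 (le_lt_trans _ m1) ?le_max ?lexx// => /(_ isT isT).
  by apply/negP; rewrite -ltNge (le_lt_trans _ m1)// le_max lexx orbT.
- exfalso; have := xC (Num.max t (expR C) + 1).
  rewrite ltry (@le_lt_trans _ _ (Num.max t (expR C))) ?le_max ?lexx ?ltrDl// => /(_ isT isT).
  apply/negP; rewrite -ltNge.
  by rewrite (@le_lt_trans _ _ (Num.max t (expR C))) ?le_max ?lexx ?ltrDl ?orbT.
Qed.

(** The counterpart on the left: a lower bound on the logarithm keeps the end point away from 0. *)
Lemma left_end_log_ge (R : realType) (t C a : R) :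
  0 <= a -> a < t -> (forall x, a < x -> x < t -> C <= ln x) ->
  0 < a /\ C <= ln a.
Proof.
move=> a0 at_ lnC.
suff Ca : expR C <= a.
  have a_gt0 : 0 < a by rewrite (lt_le_trans _ Ca)// expR_gt0.
  by rewrite a_gt0 -[C]expRK ler_ln ?posrE ?expR_gt0.
rewrite leNgt; apply/negP => aC.
have am : a < Num.min t (expR C) by rewrite lt_min at_.
have [m1 m2] := midf_lt am.
move: m2; rewrite lt_min => /andP[mt mC].
have := lnC _ m1 mt; apply/negP; rewrite -ltNge -[ltRHS]expRK ltr_ln ?posrE ?expR_gt0//.
exact: le_lt_trans m1.
Qed.

Section differential_inequality.
Variables (R : realType) (r1 : R) (r3 : \bar R) (G : R -> R) (delta gamma : R).
Hypothesis r1_ge0 : 0 <= r1.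
Hypothesis delta_gt0 : 0 < delta.
Hypothesis ndG : forall x y, oitv r1%:E r3 x -> oitv r1%:E r3 y -> x <= y -> G x <= G y.
Hypothesis odeG : {ae @lebesgue_measure R, forall r, oitv r1%:E r3 r ->
  derivable G r 1 /\ delta / r * `|G r| `^ (1 + gamma) <= derive1 G r}.

(** By the chain rule the derivative of [psi \o G] is at least [delta * k / x], whose integral is
    the logarithm on the left. All conditions on [psi] are confined to values between [G a] and
    [G b], because the functions used are singular at 0. *)
Lemma transform_growth (psi dpsi : R -> R) (k a b : R) :
  oitv r1%:E r3 a -> oitv r1%:E r3 b -> a < b -> 0 <= k ->
  (forall y z, G a <= y -> y <= z -> z <= G b -> psi y <= psi z) ->
  (forall y, G a <= y <= G b -> [/\ is_derive y 1 psi (dpsi y),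
     0 <= dpsi y & k <= dpsi y * `|y| `^ (1 + gamma)]) ->
  delta * k * (ln b - ln a) <= psi (G b) - psi (G a).
Proof.
move=> Ia Ib ab k0 ndpsi dpsiP.
have a0 : 0 < a by move: Ia => /andP[+ _]; rewrite lte_fin; exact: le_lt_trans.
have Iab x : a <= x <= b -> oitv r1%:E r3 x.
  move=> /andP[ax xb]; move: Ia Ib => /andP[r1a _] /andP[_ br3].
  by rewrite /oitv/= (lt_le_trans r1a) ?lee_fin// (le_lt_trans _ br3) ?lee_fin.
have Goo x : oitv a%:E b%:E x -> G a <= G x <= G b /\ oitv r1%:E r3 x.
  rewrite /oitv/= !lte_fin => /andP[ax xb].
  have Ix : oitv r1%:E r3 x by apply: Iab; rewrite !ltW.
  by split => //; rewrite !ndG// ltW.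
have Gab : G a <= G b by rewrite ndG// ltW.
rewrite -lee_fin mulrBr.
have <- : (\int[@lebesgue_measure R]_(x in oitv a%:E b%:E) (delta * k / x)%:E =
    (delta * k * ln b - delta * k * ln a)%:E)%E.
  apply: (@integral_oo_is_derive _ (fun x => delta * k * ln x)) => // x /andP[ax _].
    have x0 := lt_le_trans a0 ax.
    exact: (is_deriveZ (delta * k) (is_derive1_ln x0)).
  by apply: cvgM; [exact: cvg_cst|apply: cvgV; rewrite ?gt_eqF// (lt_le_trans a0)].
apply: (@integral_derive1_nondecreasing R a%:E b%:E (psi \o G) (psi (G a)) (psi (G b))).
- exact: ndpsi.
- move=> x y /Goo[/andP[Gax _] Ix] /Goo[/andP[_ Gyb] Iy] xy.
  by apply: ndpsi => //; exact: ndG.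
- move=> x /Goo[/andP[Gax Gxb] Ix]; rewrite !ndpsi//.
- move=> x; rewrite /oitv/= !lte_fin => /andP[ax _].
  by rewrite lee_fin divr_ge0 ?mulr_ge0// ltW// (lt_trans a0).
apply: ae_lebesgueW odeG => x ode /Goo[Gx Ix]; right.
have [dG Gx'] := ode Ix; have [dpsiGx dpsi0 kdpsi] := dpsiP _ Gx.
have x0 : 0 < x by move: Ix => /andP[+ _]; rewrite lte_fin; exact: le_lt_trans.
have dcomp := is_derive1_comp dpsiGx (derivableP dG).
rewrite derive1E (@derive_val _ _ _ _ _ _ _ dcomp); split; first exact: ex_derive.
rewrite lee_fin -derive1E; apply: le_trans (ler_wpM2l dpsi0 Gx').
by rewrite mulrCA mulrAC; apply: ler_wpM2l => //; rewrite divr_ge0// ltW.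
Qed.

Lemma decay_above (a b : R) : 0 < gamma ->
  oitv r1%:E r3 a -> oitv r1%:E r3 b -> a < b -> 0 < G a ->
  G b `^ (- gamma) + delta * gamma * (ln b - ln a) <= G a `^ (- gamma).
Proof.
move=> gamma0 Ia Ib ab Ga.
rewrite -lerBrDl [leRHS]addrC -[X in _ <= _ + X]opprK.
apply: (@transform_growth (fun y => - y `^ (- gamma))
  (fun y => gamma * y `^ (- gamma - 1)) gamma a b Ia Ib ab (ltW gamma0)).
- move=> y z ay yz zb; have y0 := lt_le_trans Ga ay; have z0 := lt_le_trans y0 yz.
  rewrite lerN2 !powRN lef_pV2 ?posrE ?powR_gt0//.
  by rewrite ge0_ler_powR ?nnegrE// ltW.
- move=> y /andP[ay _]; have y0 : 0 < y by exact: lt_le_trans ay.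
  split.
  + rewrite -[X in is_derive _ _ _ X]opprK -mulNr.
    exact: is_deriveN (is_derive1_powR _ y0).
  + by rewrite mulr_ge0 ?powR_ge0// ltW.
  + rewrite gtr0_norm// -mulrA -powRD ?(gt_eqF y0) ?implybT//.
    by rewrite -opprD [1 + _]addrC addNr powRr0 mulr1.
Qed.

Lemma decay_below (a b : R) : 0 < gamma ->
  oitv r1%:E r3 a -> oitv r1%:E r3 b -> a < b -> G b < 0 ->
  (- G a) `^ (- gamma) + delta * gamma * (ln b - ln a) <= (- G b) `^ (- gamma).
Proof.
move=> gamma0 Ia Ib ab Gb.
rewrite -lerBrDl.
apply: (@transform_growth (fun y => (- y) `^ (- gamma))
  (fun y => gamma * (- y) `^ (- gamma - 1)) gamma a b Ia Ib ab (ltW gamma0)).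
- move=> y z ay yz zb; have z0 := le_lt_trans zb Gb; have y0 := le_lt_trans yz z0.
  rewrite !powRN lef_pV2 ?posrE ?powR_gt0 ?oppr_gt0//.
  by rewrite ge0_ler_powR ?nnegrE ?lerN2// ltW// oppr_gt0.
- move=> y /andP[_ yb]; have y0 : 0 < - y by rewrite oppr_gt0 (le_lt_trans yb).
  split.
  + have -> : gamma * (- y) `^ (- gamma - 1) = (- gamma * (- y) `^ (- gamma - 1)) * (- 1).
      by rewrite mulrN1 mulNr opprK.
    exact: (is_derive1_comp (is_derive1_powR (- gamma) y0) (is_deriveN (is_derive_id y 1))).
  + by rewrite mulr_ge0 ?powR_ge0// ltW.
  + rewrite -normrN gtr0_norm// -mulrA -powRD ?(gt_eqF y0) ?implybT//.
    by rewrite -opprD [1 + _]addrC addNr powRr0 mulr1.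
Qed.

Lemma decay_above0 (a b : R) : gamma = 0 ->
  oitv r1%:E r3 a -> oitv r1%:E r3 b -> a < b -> 0 < G a ->
  ln (G a) + delta * (ln b - ln a) <= ln (G b).
Proof.
move=> gamma0 Ia Ib ab Ga; rewrite -lerBrDl -[delta]mulr1.
apply: (@transform_growth (@ln R) (@GRing.inv R) 1 a b Ia Ib ab ler01).
- move=> y z ay yz zb; rewrite ler_ln ?posrE ?(lt_le_trans Ga)//.
  exact: le_trans yz.
- move=> y /andP[ay _]; have y0 : 0 < y by exact: lt_le_trans ay.
  split; first exact: is_derive1_ln.
  + by rewrite invr_ge0 ltW.
  + by rewrite gamma0 addr0 powRr1// gtr0_norm// mulVf ?gt_eqF.
Qed.

Lemma decay_below0 (a b : R) : gamma = 0 ->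
  oitv r1%:E r3 a -> oitv r1%:E r3 b -> a < b -> G b < 0 ->
  ln (- G b) + delta * (ln b - ln a) <= ln (- G a).
Proof.
move=> gamma0 Ia Ib ab Gb.
rewrite -lerBrDl [leRHS]addrC -[X in _ <= _ + X]opprK -[delta]mulr1.
apply: (@transform_growth (fun y => - ln (- y)) (fun y => (- y)^-1) 1 a b Ia Ib ab ler01).
- move=> y z ay yz zb; have z0 := le_lt_trans zb Gb; have y0 := le_lt_trans yz z0.
  by rewrite lerN2 ler_ln ?posrE ?oppr_gt0// lerN2.
- move=> y /andP[_ yb]; have y0 : 0 < - y by rewrite oppr_gt0 (le_lt_trans yb).
  split.
  + have -> : (- y)^-1 = - ((- y)^-1 * (- 1)) by rewrite mulrN1 opprK.
    exact: (is_deriveN (is_derive1_comp (is_derive1_ln y0) (is_deriveN (is_derive_id y 1)))).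
  + by rewrite invr_ge0 ltW.
  + by rewrite -normrN gamma0 addr0 powRr1// gtr0_norm// mulVf ?gt_eqF.
Qed.

(** A solution that is positive at [t] would blow up in finite logarithmic time. Thus positivity of
    [G] at one point forces [r3] to be finite, and the decay estimate extends up to [r3] with [L] in
    place of the end value. *)
Lemma above_bound (t L : R) : 0 < gamma -> oitv r1%:E r3 t -> 0 < G t ->
  (forall x, oitv r1%:E r3 x -> G x <= L) ->
  exists2 rho, r3 = rho%:E &
    L `^ (- gamma) + delta * gamma * (ln rho - ln t) <= G t `^ (- gamma).
Proof.
move=> gamma0 It Gt0 GL; have /andP[r1t tr3] := It.
have t0 : 0 < t by move: r1t; rewrite lte_fin; exact: le_lt_trans.
have dg0 : 0 < delta * gamma by rewrite mulr_gt0.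
have L0 : 0 < L by exact: lt_le_trans (GL _ It).
(* The constant is the decay inequality solved for [ln x], with [G x] replaced by [L]. *)
have := @right_end_log_le R t (ln t + (G t `^ (- gamma) - L `^ (- gamma)) / (delta * gamma)) r3 t0 tr3.
case=> [x tx xr3|rho r3E lnrho].
  have Ix : oitv r1%:E r3 x by rewrite /oitv/= xr3 (lt_trans r1t).
  rewrite -lerBlDl ler_pdivlMr// lerBrDl mulrC.
  apply: le_trans (decay_above _ _ gamma0 It Ix tx Gt0).
  rewrite lerD2r !powRN lef_pV2 ?posrE ?powR_gt0//; last first.
    by rewrite (lt_le_trans Gt0)// ndG// ltW.
  by rewrite ge0_ler_powR ?nnegrE ?GL// ltW// (lt_le_trans Gt0)// ndG// ltW.
exists rho => //.
by rewrite -lerBrDl mulrC -ler_pdivlMr// lerBlDl.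
Qed.

(** Here the blow-up happens for decreasing radii, so a negative value of [G] forces [r1] to be
    positive. *)
Lemma below_bound (t L : R) : 0 < gamma -> oitv r1%:E r3 t -> G t < 0 ->
  (forall x, oitv r1%:E r3 x -> L <= G x) ->
  0 < r1 /\
    (- L) `^ (- gamma) + delta * gamma * (ln t - ln r1) <= (- G t) `^ (- gamma).
Proof.
move=> gamma0 It Gt0 GL; have /andP[r1t tr3] := It.
have dg0 : 0 < delta * gamma by rewrite mulr_gt0.
have L0 : L < 0 by exact: le_lt_trans (GL _ It) _.
have := @left_end_log_ge R t (ln t - ((- G t) `^ (- gamma) - (- L) `^ (- gamma)) / (delta * gamma)) r1 r1_ge0 r1t.
case=> [x rx xt|r10 lnr1].
  have Ix : oitv r1%:E r3 x by rewrite /oitv/= lte_fin rx (lt_trans _ tr3).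
  rewrite lerBlDl -lerBlDr ler_pdivlMr// lerBrDl mulrC.
  apply: le_trans (decay_below _ _ gamma0 Ix It xt Gt0).
  have Gx0 : G x < 0 by rewrite (le_lt_trans _ Gt0)// ndG// ltW.
  rewrite lerD2r !powRN lef_pV2 ?posrE ?powR_gt0 ?oppr_gt0//.
  by rewrite ge0_ler_powR ?nnegrE ?lerN2 ?GL// ltW// oppr_gt0.
split=> //; rewrite -lerBrDl mulrC -ler_pdivlMr// lerBlDl.
by rewrite -lerBlDr.
Qed.

(** In the linear case [G] grows at least like the power [delta] of the radius, which the upper
    bound [L] must stop at a finite radius. *)
Lemma above_bound0 (t L : R) : gamma = 0 -> oitv r1%:E r3 t -> 0 < G t ->
  (forall x, oitv r1%:E r3 x -> G x <= L) ->
  exists2 rho, r3 = rho%:E & ln (G t) + delta * (ln rho - ln t) <= ln L.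
Proof.
move=> gamma0 It Gt0 GL; have /andP[r1t tr3] := It.
have t0 : 0 < t by move: r1t; rewrite lte_fin; exact: le_lt_trans.
have L0 : 0 < L by exact: lt_le_trans (GL _ It).
have := @right_end_log_le R t (ln t + (ln L - ln (G t)) / delta) r3 t0 tr3.
case=> [x tx xr3|rho r3E lnrho].
  have Ix : oitv r1%:E r3 x by rewrite /oitv/= xr3 (lt_trans r1t).
  rewrite -lerBlDl ler_pdivlMr// lerBrDl mulrC.
  apply: le_trans (decay_above0 _ _ gamma0 It Ix tx Gt0) _.
  by rewrite ler_ln ?posrE ?GL// (lt_le_trans Gt0)// ndG// ltW.
exists rho => //.
by rewrite -lerBrDl mulrC -ler_pdivlMr// lerBlDl.
Qed.

Lemma below_bound0 (t L : R) : gamma = 0 -> oitv r1%:E r3 t -> G t < 0 ->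
  (forall x, oitv r1%:E r3 x -> L <= G x) ->
  0 < r1 /\ ln (- G t) + delta * (ln t - ln r1) <= ln (- L).
Proof.
move=> gamma0 It Gt0 GL; have /andP[r1t tr3] := It.
have L0 : L < 0 by exact: le_lt_trans (GL _ It) _.
have := @left_end_log_ge R t (ln t - (ln (- L) - ln (- G t)) / delta) r1 r1_ge0 r1t.
case=> [x rx xt|r10 lnr1].
  have Ix : oitv r1%:E r3 x by rewrite /oitv/= lte_fin rx (lt_trans _ tr3).
  rewrite lerBlDl -lerBlDr ler_pdivlMr// lerBrDl mulrC.
  apply: le_trans (decay_below0 _ _ gamma0 Ix It xt Gt0) _.
  have Gx0 : G x < 0 by rewrite (le_lt_trans _ Gt0)// ndG// ltW.
  by rewrite ler_ln ?posrE ?oppr_gt0 ?lerN2 ?GL.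
split=> //; rewrite -lerBrDl mulrC -ler_pdivlMr// lerBlDl.
by rewrite -lerBlDr.
Qed.

End differential_inequality.

(** * Length of a curve with controlled speed *)

(* For p = (1 - gamma) / 2 its derivative is proportional to |y|^(-(1 + gamma) / 2),
   the factor that turns the bound on the speed into an exact derivative. *)
Definition sgpow {R : realType} (p y : R) : R := Num.sg y * `|y| `^ p.

(** The condition on [p] concerns [y = 0]: there [sgpow] vanishes, while the power of 0 with
    exponent 0 is 1. *)
Lemma sgpow_ge0E (R : realType) (p y : R) : p != 0 -> 0 <= y -> sgpow p y = y `^ p.
Proof.
move=> p0; rewrite le_eqVlt => /predU1P[<-|y0].
  by rewrite /sgpow sgr0 mul0r powR0.
by rewrite /sgpow gtr0_sg// mul1r gtr0_norm.
Qed.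

Lemma sgpowN (R : realType) (p y : R) : sgpow p (- y) = - sgpow p y.
Proof. by rewrite /sgpow sgrN normrN mulNr. Qed.

Lemma sgpow_le0E (R : realType) (p y : R) : p != 0 -> y <= 0 -> sgpow p y = - (- y) `^ p.
Proof. by move=> p0 y0; rewrite -[y in LHS]opprK sgpowN sgpow_ge0E// oppr_ge0. Qed.

Lemma sgpow_ge0 (R : realType) (p y : R) : 0 <= y -> 0 <= sgpow p y.
Proof. by move=> y0; rewrite mulr_ge0 ?sgr_ge0 ?powR_ge0. Qed.

Lemma le_sgpow (R : realType) (p y z : R) : 0 < p -> y <= z -> sgpow p y <= sgpow p z.
Proof.
move=> p0 yz; have pn0 : p != 0 by rewrite gt_eqF.
have [y0|/ltW y0] := leP 0 y.
  have z0 := le_trans y0 yz.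
  by rewrite !sgpow_ge0E// ge0_ler_powR ?nnegrE// ltW.
have [z0|/ltW z0] := leP 0 z.
  rewrite (@le_trans _ _ 0)//; first by rewrite -oppr_ge0 -sgpowN sgpow_ge0 ?oppr_ge0.
  exact: sgpow_ge0.
by rewrite !sgpow_le0E// lerN2 ge0_ler_powR ?nnegrE ?oppr_ge0 ?lerN2// ltW.
Qed.

Lemma is_derive_sgpow (R : realType) (p y : R) : p != 0 -> y != 0 ->
  is_derive y 1 (sgpow p) (p * `|y| `^ (p - 1)).
Proof.
move=> p0; rewrite neq_lt => /orP[y0|y0].
  apply: (@near_eq_is_derive _ _ _ (fun x => - (- x) `^ p)).
    near=> x; rewrite sgpow_le0E// ltW//; near: x.
    exact: lt_nbhsl.
  have Ny0 : 0 < - y by rewrite oppr_gt0.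
  rewrite ltr0_norm// -[X in is_derive _ _ _ X]opprK -[X in is_derive _ _ _ (- X)]mulrN1.
  exact: (is_deriveN (is_derive1_comp (is_derive1_powR p Ny0) (is_deriveN (is_derive_id y 1)))).
apply: (@near_eq_is_derive _ _ _ (fun x => x `^ p)).
  near=> x; rewrite sgpow_ge0E// ltW//; near: x.
  exact: lt_nbhsr.
by rewrite gtr0_norm//; exact: is_derive1_powR.
Unshelve. all: by end_near. Qed.

Lemma derive1_eq0_right (R : realType) (G : R -> R) (x y : R) :
  derivable G x 1 -> x < y -> (forall z, x <= z -> z < y -> G z = G x) ->
  derive1 G x = 0.
Proof.
move=> dG xy Gxy; have dGx := @derivable_harmonic_cvg _ _ _ dG.
apply: (cvg_unique _ dGx) => //; apply: cvg_near_cst.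
near=> n; rewrite Gxy ?subrr ?mulr0//.
- by rewrite lerDl harmonic_ge0.
- rewrite -ltrBrDl; near: n.
  by have := @cvg_harmonic R; move/cvgr_lt; apply; rewrite subr_gt0.
Unshelve. all: by end_near. Qed.

(** Between two zeros a monotone [G] is constant, so its derivative at the left one vanishes. At
    most one point, the right end of the zero level, is exceptional. This handles the points where
    [sgpow p] is not differentiable. *)
Lemma ae_derive1_level0 (R : realType) (I : set R) (G : R -> R) :
  (forall x y, I x -> I y -> x <= y -> G x <= G y) ->
  (forall x y z, I x -> I y -> x <= z <= y -> I z) ->
  {ae @lebesgue_measure R, forall x, I x -> derivable G x 1 -> G x = 0 -> derive1 G x = 0}.
Proof.
move=> ndG Iitv.
pose E := [set x | [/\ I x, derivable G x 1, G x = 0 & derive1 G x != 0]].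
have E1 x y : E x -> E y -> ~ x < y.
  move=> [Ix dGx Gx0 /eqP G'x] [Iy _ Gy0 _] xy; apply: G'x.
  apply: (derive1_eq0_right _ _ _ y dGx xy) => z xz zy.
  have Iz : I z by apply: (Iitv x y) => //; rewrite xz ltW.
  by apply/eqP; rewrite eq_le Gx0 -{1}Gy0 -Gx0 !ndG// ltW.
have : exists x0, E `<=` [set x0].
  have [[x0 Ex0]|nE] := pselect (exists x, E x); last first.
    by exists 0 => x Ex; case: nE; exists x.
  exists x0 => x Ex /=; apply/eqP; rewrite eq_le !leNgt.
  by apply/andP; split; apply/negP; exact: E1.
case=> x0 Ex0; exists [set x0]; split => //.
  exact: lebesgue_measure_set1.
move=> x /= nx; apply: Ex0; apply: contrapT => nE; apply: nx => Ix dG Gx0.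
by apply/eqP; apply: contrapT => /negP G'x; apply: nE; split.
Qed.

(** The numbers [A] and [B] are arbitrary bounds rather than end values, so that one-sided limits as
    well as decay bounds can be inserted for them. *)
Lemma integral_speed_le (R : realType) (r1 : R) (r3 : \bar R) (G : R -> R)
    (delta gamma cE : R) (speed : R -> \bar R) (s r : \bar R) (A B : R) :
  0 <= r1 -> 0 < delta -> 0 < cE -> gamma < 1 ->
  (forall x y, oitv r1%:E r3 x -> oitv r1%:E r3 y -> x <= y -> G x <= G y) ->
  {ae @lebesgue_measure R, forall x, oitv r1%:E r3 x ->
    derivable G x 1 /\ delta / x * `|G x| `^ (1 + gamma) <= derive1 G x} ->
  (forall x, oitv s r x -> 0 <= speed x)%E ->
  {ae @lebesgue_measure R, forall x, oitv r1%:E r3 x ->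
    (speed x <= (Num.sqrt (derive1 G x / (cE * x)))%:E)%E} ->
  oitv s r `<=` oitv r1%:E r3 -> A <= B ->
  (forall x, oitv s r x -> A <= sgpow ((1 - gamma) / 2) (G x) <= B) ->
  (\int[@lebesgue_measure R]_(x in oitv s r) speed x <=
    (((1 - gamma) / 2 * Num.sqrt (cE * delta))^-1 * (B - A))%:E)%E.
Proof.
move=> r10 delta0 cE0 gamma1 ndG odeG speed0 speedG sub AB GAB.
set p := (1 - gamma) / 2; set C := (_ * _)^-1.
have p0 : 0 < p by rewrite divr_gt0// subr_gt0.
have sq0 : 0 < Num.sqrt (cE * delta) by rewrite sqrtr_gt0 mulr_gt0.
have C0 : 0 < C by rewrite invr_gt0 mulr_gt0.
rewrite mulrBr; apply: (@integral_derive1_nondecreasing _ _ _ (fun x => C * sgpow p (G x))) => //.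
- by rewrite ler_pM2l.
- by move=> x y /sub Ix /sub Iy xy; rewrite ler_pM2l// le_sgpow// ndG.
- by move=> x /GAB; rewrite !ler_pM2l.
have level0 : {ae @lebesgue_measure R, forall x, oitv r1%:E r3 x ->
    derivable G x 1 -> G x = 0 -> derive1 G x = 0}.
  apply: ae_derive1_level0 => // x y z /andP[r1x _] /andP[_ yr3] /andP[xz zy].
  by rewrite /oitv/= (lt_le_trans r1x) ?lee_fin// (le_lt_trans _ yr3)// lee_fin.
have both := ae_lebesgueW2 _ _ _ _ (fun x H1 H2 => conj H1 H2) odeG level0.
apply: (ae_lebesgueW2 _ _ _ _ _ speedG both) => x speedx [odex lev0x] /sub Ix.
have x0 : 0 < x by move: Ix => /andP[+ _]; rewrite lte_fin; exact: le_lt_trans.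
have [dG G'x] := odex Ix; have {}speedx := speedx Ix.
have [Gx0|Gx0] := eqVneq (G x) 0.
  by left; rewrite (le_trans speedx)// (lev0x Ix)// mul0r sqrtr0.
right.
have dphi := is_derive_sgpow _ _ _ (lt0r_neq0 p0) Gx0.
have dcomp := is_deriveZ C (is_derive1_comp dphi (derivableP dG)).
rewrite derive1E; split; first exact: (@ex_derive _ _ _ _ _ _ _ dcomp).
rewrite (le_trans speedx)// lee_fin (@derive_val _ _ _ _ _ _ _ dcomp) -derive1E.
set g' := derive1 G x in G'x *.
set w := `|G x| `^ (p - 1).
have w0 : 0 < w by apply: powR_gt0; rewrite normr_gt0.
have g'0 : 0 <= g' by apply: le_trans G'x; rewrite mulr_ge0 ?powR_ge0// divr_ge0// ltW.
(* The exponent of [w] is [p - 1 = - (1 + gamma) / 2]; this dictates the choice of [p]. *)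
have w2 : w ^+ 2 * `|G x| `^ (1 + gamma) = 1.
  rewrite expr2 -!powRD ?normr_eq0 ?Gx0 ?implybT//.
  by rewrite (_ : _ + _ = 0) ?powRr0// /p; field.
have sqcd : Num.sqrt (cE * delta) ^+ 2 = cE * delta by rewrite sqr_sqrtr// mulr_ge0// ltW.
have -> : C *: (p * w * g') = w * g' / Num.sqrt (cE * delta).
  rewrite /C; apply/eqP; rewrite -subr_eq0; apply/eqP.
  rewrite /GRing.scale/=; field; by rewrite !lt0r_neq0.
rewrite -[leRHS]ger0_norm; last by rewrite !mulr_ge0 ?invr_ge0// ltW.
(* It remains to compare the squares. With denominators cleared, this is the differential inequality
   times [w ^+ 2], multiplied by the nonnegative factor [g' * cE]. *)
rewrite -sqrtr_sqr ler_wsqrtr//.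
rewrite expr_div_n sqcd exprMn.
rewrite ler_pdivrMr ?mulr_gt0// mulrAC ler_pdivlMr ?mulr_gt0//.
clear speedx odex lev0x.
have := ler_wpM2l (ltW (exprn_gt0 2 w0)) G'x.
rewrite mulrCA w2 mulr1 ler_pdivrMr// => dxw.
rewrite -subr_ge0 (_ : _ - _ = g' * cE * (w ^+ 2 * g' * x - delta)); last by ring.
by rewrite !mulr_ge0 ?subr_ge0// ltW.
Qed.

(** * The energy inequality *)

(* G differs from E(z_r) by at most a bounded b = O(r G'), whence
   |G|^(1+gamma) <= 4 (|E(z_r)|^(1+gamma) + b^(1+gamma)) = O(r G'); the constant
   collects the implied factors. *)
Definition rate {R : realType} (cE eps alpha : R) : R :=
  (4 * ((cE * eps)^-1 + (2 + 6 / alpha) * (cE^-1 + 3 / alpha)))^-1.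

Lemma rate_gt0 (R : realType) (cE eps alpha : R) :
  0 < cE -> 0 < eps -> 0 < alpha -> 0 < rate cE eps alpha.
Proof.
move=> cE0 eps0 alpha0.
by rewrite invr_gt0 mulr_gt0// addr_gt0// ?invr_gt0 mulr_gt0// addr_gt0// ?invr_gt0 ?divr_gt0.
Qed.

(** The sum is at most twice the maximum, and [p <= 2] bounds the resulting factor by 4. *)
Lemma powRD_le (R : realType) (x y p : R) : 0 <= x -> 0 <= y -> 0 <= p <= 2 ->
  (x + y) `^ p <= 4 * (x `^ p + y `^ p).
Proof.
move=> x0 y0 /andP[p0 p2]; set m := Num.max x y.
have m0 : 0 <= m by rewrite le_max x0.
have xym : x + y <= 2 * m by rewrite mulr_natl mulr2n lerD// /m le_max lexx ?orbT.
apply: (@le_trans _ _ ((2 * m) `^ p)).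
  by rewrite ge0_ler_powR ?nnegrE ?addr_ge0 ?mulr_ge0.
rewrite powRM//; apply: ler_pM; rewrite ?powR_ge0//.
  have -> : 4 = 2 `^ 2 :> R by rewrite powR_mulrn// -natrX.
  by rewrite ler_powR// ler1n.
by rewrite /m maxEle; case: ifP => _; rewrite ?lerDr ?lerDl powR_ge0.
Qed.

(** One factor [b] is kept and the remaining power [gamma] is bounded through [K]: here the a priori
    bounds on energy and errors enter. *)
Lemma powR1D_le (R : realType) (b K gamma : R) : 0 <= b <= K -> 1 <= K -> 0 <= gamma <= 1 ->
  b `^ (1 + gamma) <= K * b.
Proof.
move=> /andP[b0 bK] K1 /andP[g0 g1].
have [->|bn0] := eqVneq b 0; first by rewrite powR0 ?mulr0// gt_eqF// ltr_pwDl.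
rewrite powRD; last by rewrite bn0 implybT.
rewrite powRr1// mulrC ler_wpM2r//.
apply: (@le_trans _ _ (K `^ gamma)); first by rewrite ge0_ler_powR ?nnegrE// (le_trans b0).
by rewrite -[leRHS]powRr1 ?ler_powR// (le_trans b0).
Qed.

(* [X] plays the role of [r G'(r)], [e] and [ez] those of the energies of [u_r]
   and of its homogeneous extension, [A] that of the error terms. *)
Lemma rate_le (R : realType) (cE eps gamma alpha e ez A D X g : R) :
  0 < cE <= 1 -> 0 < eps <= 1 -> 0 <= gamma < 1 -> 0 < alpha <= 1 ->
  -1 <= e <= 1 -> -1 <= ez <= 1 -> 0 <= A <= 2 -> 0 <= D ->
  cE * (ez - e) + cE * D + 2 * A <= X ->
  e <= ez - eps * `|ez| `^ (1 + gamma) + A ->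
  `|g - e| <= 3 / alpha * A ->
  cE * D <= X /\ rate cE eps alpha * `|g| `^ (1 + gamma) <= X.
Proof.
move=> /andP[cE0 cE1] /andP[eps0 eps1] /andP[g0 g1] /andP[a0 a1] e1 ez1
  /andP[A0 A2] D0 HX He Hg.
set P := `|ez| `^ (1 + gamma) in He.
have P0 : 0 <= P by exact: powR_ge0.
have epsP0 : 0 <= eps * P by rewrite mulr_ge0// ltW.
(* By the comparison inequality and [cE <= 1], [cE * (ez - e)] is at least [cE * eps * P - A]. Of
   the [2 * A] available one [A] survives, so [X] dominates the sum of [cE * D], [cE * eps * P] and
   [A]. *)
have cA : 0 <= (1 - cE) * A by rewrite mulr_ge0// subr_ge0.
have ezeA : 0 <= cE * (ez - e - eps * P + A) by rewrite mulr_ge0 ?(ltW cE0)//; lra.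
have cD0 : 0 <= cE * D by rewrite mulr_ge0// ltW.
have cepsP0 : 0 <= cE * (eps * P) by rewrite mulr_ge0// ltW.
have X1 : cE * D <= X by lra.
split=> //.
have AX : A <= X by lra.
have PX : cE * eps * P <= X by lra.
have X0 : 0 <= X by exact: le_trans AX.
(* If [ez] is the larger one, the inequality for [X] gives this directly; if [e] is, the comparison
   inequality bounds the difference by [A <= X]. *)
have eX : `|e - ez| <= X / cE.
  by rewrite ler_norml lerNl !ler_pdivlMr//; apply/andP; split; lra.
(* The 2 bounds the difference of two energies in [-1, 1]; the [6 / alpha] bounds [3 / alpha * A]
   with [A <= 2]. *)
set K : R := 2 + 6 / alpha.
have ia0 : 0 < alpha^-1 by rewrite invr_gt0.
have K1 : 1 <= K by rewrite /K; lra.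
set b : R := `|e - ez| + 3 / alpha * A.
have b0 : 0 <= b by rewrite addr_ge0// mulr_ge0// divr_ge0// ltW.
have bK : b <= K.
  rewrite lerD//; first by rewrite ler_norml; lra.
  have : 0 <= (2 - A) / alpha by rewrite mulr_ge0 ?(ltW ia0)// subr_ge0.
  lra.
have bX : b <= (cE^-1 + 3 / alpha) * X.
  by rewrite mulrDl lerD ?[cE^-1 * _]mulrC// ler_wpM2l// divr_ge0// ltW.
have gb : `|g| <= `|ez| + b.
  rewrite (_ : g = ez + ((e - ez) + (g - e))); last by ring.
  by rewrite (le_trans (ler_normD _ _))// lerD2l (le_trans (ler_normD _ _))// lerD2l.
have main : `|g| `^ (1 + gamma) <= 4 * (P + K * b).
  apply: (@le_trans _ _ ((`|ez| + b) `^ (1 + gamma))).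
    by rewrite ge0_ler_powR ?nnegrE ?normr_ge0 ?(addr_ge0 _ g0)// addr_ge0.
  apply: le_trans (powRD_le _ _ _ _ _ b0 _) _ => //; first by lra.
  by rewrite ler_pM2l// lerD2l powR1D_le ?b0// g0 ltW.
have r0 : 0 < rate cE eps alpha by exact: rate_gt0.
rewrite mulrC -ler_pdivlMr// (le_trans main)// invrK [leRHS]mulrCA ler_pM2l// [leRHS]mulrDr.
rewrite lerD//; first by rewrite ler_pdivlMr ?mulr_gt0// mulrC.
by rewrite [leRHS]mulrCA ler_wpM2l 1?[_ * (_ + _)]mulrC// (le_trans _ K1).
Qed.

(* The integral of [e'] is at least minus that of its negative part, hence at
   least minus that of [g]. *)
Lemma nondecreasing_of_integral_derive1_le (R : realType) (a b : \bar R) (e g h : R -> R) :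
  (forall x y, x < y -> `[x, y] `<=` oitv a b ->
    (\int[@lebesgue_measure R]_(t in `[x, y]) (derive1 e t)%:E <= (e y - e x)%:E)%E) ->
  {ae @lebesgue_measure R, forall x, oitv a b x -> - g x <= derive1 e x} ->
  (forall x, oitv a b x ->
    [/\ 0 <= g x, is_derive x 1 h (g x) & {for x, continuous g}]) ->
  forall x y, oitv a b x -> oitv a b y -> x <= y -> e x + h x <= e y + h y.
Proof.
move=> inte ge hg x y Ix Iy; rewrite le_eqVlt => /predU1P[->//|xy].
have Ixy z : x <= z <= y -> oitv a b z.
  move=> /andP[xz zy]; move: Ix Iy => /andP[ax _] /andP[_ yb].
  by rewrite /oitv/= (lt_le_trans ax) ?lee_fin// (le_lt_trans _ yb) ?lee_fin.
have sub : `[x, y] `<=` oitv a b by move=> z /=; rewrite in_itv/=; exact: Ixy.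
have intg : (\int[@lebesgue_measure R]_(t in `[x, y]) (g t)%:E = (h y - h x)%:E)%E.
  by apply: integral_is_derive => // z /Ixy /hg[].
have mg : measurable_fun `[x, y] (EFin \o g).
  apply/measurable_EFinP; apply: subspace_continuous_measurable_fun => //.
  by apply: continuous_in_subspaceT => z; rewrite inE => /sub /hg[].
suff le : (- (h y - h x)%:E <= \int[@lebesgue_measure R]_(t in `[x, y]) (derive1 e t)%:E)%E.
  by have := le_trans le (inte _ _ xy sub); rewrite -EFinN lee_fin; lra.
rewrite integralE -[leLHS]add0e; apply: leeB; first exact: integral_ge0.
rewrite -intg; apply: ge0_le_integral_ae => //.
- by move=> z /sub /hg[gz _ _]; rewrite lee_fin.
- apply: ae_lebesgueW ge => z gez /sub Iz; have [gz _ _] := hg z Iz.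
  by rewrite funenegE ge_max -EFinN !lee_fin gz lerNl gez.
Qed.

(** The opposite signs and the factor [alpha^-1] are chosen so that both terms contribute positively
    and without [alpha] to the derivative. *)
Lemma is_derive_error (R : realType) (alpha Lp Lm r : R) : 0 < alpha -> 0 < r ->
  is_derive r 1 (fun r => 3 * alpha^-1 * Lp * r `^ alpha - 3 * alpha^-1 * Lm * r `^ (- alpha))
    (3 * Lp * r `^ (alpha - 1) + 3 * Lm * r `^ (- alpha - 1)).
Proof.
move=> a0 r0.
have := is_deriveB (is_deriveZ (3 * alpha^-1 * Lp) (is_derive1_powR alpha r0))
  (is_deriveZ (3 * alpha^-1 * Lm) (is_derive1_powR (- alpha) r0)).
rewrite (_ : _ *: _ - _ = 3 * Lp * r `^ (alpha - 1) + 3 * Lm * r `^ (- alpha - 1))//.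
by rewrite /GRing.scale/=; field; rewrite gt_eqF.
Qed.

Lemma continuous_powR (R : realType) (p x : R) : 0 < x -> {for x, continuous (fun y => y `^ p)}.
Proof.
move=> x0; apply: differentiable_continuous; apply/derivable1_diffP.
exact: (@ex_derive _ _ _ _ _ _ _ (is_derive1_powR p x0)).
Qed.

(** The hypothesis is raised to the negative power [- q], which reverses it; [q] satisfies
    [gamma * q = (1 - gamma) / 2]. *)
Lemma powR_decay_le (R : realType) (gamma X y : R) :
  0 < gamma < 1 -> 0 < X -> 0 < y -> X <= y `^ (- gamma) ->
  y `^ ((1 - gamma) / 2) <= X `^ ((gamma - 1) / (2 * gamma)).
Proof.
move=> /andP[g0 g1] X0 y0 Xy.
pose q := (1 - gamma) / (2 * gamma).
have q0 : 0 <= q by rewrite divr_ge0 ?subr_ge0 ?mulr_ge0// ltW.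
have -> : (1 - gamma) / 2 = - gamma * - q by rewrite /q; field; rewrite gt_eqF.
have -> : (gamma - 1) / (2 * gamma) = - q by rewrite -mulNr opprB.
rewrite powRrM !(powRN _ q) lef_pV2 ?posrE ?powR_gt0//.
by rewrite ge0_ler_powR ?nnegrE ?powR_ge0// ltW.
Qed.

Lemma powR_decay0_le (R : realType) (d y L q : R) :
  0 < y -> 0 < L -> 0 < q -> ln y <= ln L + d * ln q ->
  y `^ 2^-1 <= L `^ 2^-1 * q `^ (d / 2).
Proof.
move=> y0 L0 q0 lnyLq.
have qd0 : 0 < q `^ d by exact: powR_gt0.
rewrite (powRrM q) -powRM ?(ltW L0) ?(ltW qd0)//.
rewrite ge0_ler_powR ?nnegrE ?invr_ge0 ?(ltW y0) ?(mulr_ge0 (ltW L0) (ltW qd0))//.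
by rewrite -ler_ln ?posrE ?mulr_gt0 ?powR_gt0// lnM ?posrE ?powR_gt0// ln_powR.
Qed.

Lemma epow_ge0 (R : realType) (x : \bar R) (p : R) : (0 <= epow x p)%E.
Proof.
rewrite /epow; case: ifP => _; last exact: poweR_ge0.
by case: x => [y| |]//; case: ifP => _; rewrite ?leey// lee_fin powR_ge0.
Qed.

Lemma epow_fin (R : realType) (y p : R) : 0 < y -> epow y%:E p = (y `^ p)%:E.
Proof. by move=> y0; rewrite /epow gt_eqF//; case: ifP => //. Qed.

Lemma log_ratio_fin (R : realType) (b a : R) : 0 < a -> 0 < b ->
  log_ratio b%:E a%:E = (ln b - ln a)%:E.
Proof.
move=> a0 b0; rewrite /log_ratio/equot/= -/(lne (a / b)%:E) lne_EFin ?divr_gt0//.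
by rewrite ln_div ?posrE// -EFinN opprB.
Qed.

(** * Limits at the end points and length estimates *)

Section extension_to_ends.
Variables (R : realType) (a : R) (b : \bar R) (G : R -> R) (M : R).
Hypothesis ndG : forall x y, oitv a%:E b x -> oitv a%:E b y -> x <= y -> G x <= G y.
Hypothesis bndG : forall x, oitv a%:E b x -> `|G x| <= M.

Lemma extend_to_ends_oitv x : oitv a%:E b x -> extend_to_ends a b G x%:E = G x.
Proof. by move=> /andP[ax xb]; rewrite /extend_to_ends leNgt ax/= leNgt xb. Qed.

Lemma extend_to_ends_left_le x : oitv a%:E b x -> extend_to_ends a b G a%:E <= G x.
Proof.
move=> Ix; have /andP[ax xb] := Ix; rewrite lte_fin in ax.
have Iy y : a < y -> y <= x -> oitv a%:E b y.
  by move=> ay yx; rewrite /oitv/= lte_fin ay (le_lt_trans _ xb)// lee_fin.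
rewrite /extend_to_ends lexx; apply: limr_le.
  apply: nondecreasing_at_right_is_cvgr.
  - near=> y => s t; rewrite !in_itv/= => /andP[as_ sy] /andP[at_ ty] st.
    have yx : y <= x by near: y; apply: nbhs_right_le.
    by apply: ndG => //; apply: Iy => //; rewrite ltW// (lt_le_trans _ yx).
  - near=> y; exists (- M) => _ /= [s + <-]; rewrite in_itv/= => /andP[as_ sy].
    have yx : y <= x by near: y; apply: nbhs_right_le.
    have := bndG _ (Iy s as_ (ltW (lt_le_trans sy yx))).
    by rewrite ler_norml => /andP[].
near=> y; have yx : y <= x by near: y; apply: nbhs_right_le.
have ay : a < y by near: y; exact: nbhs_right_gt.
by apply: ndG => //; exact: Iy.
Unshelve. all: by end_near. Qed.

Lemma le_extend_to_ends_right x : oitv a%:E b x -> G x <= extend_to_ends a b G b.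
Proof.
move=> Ix; have /andP[ax xb] := Ix.
have ab := lt_trans ax xb; rewrite lte_fin in ax.
rewrite /extend_to_ends (leNgt b) ab/= lexx.
have Iy y : x <= y -> (y%:E < b)%E -> oitv a%:E b y.
  by move=> xy yb; rewrite /oitv/= lte_fin (lt_le_trans ax).
move: xb ab ndG bndG Ix Iy; case: b => [b'| |]//= xb ab ndG' bndG' Ix Iy.
- rewrite lte_fin in xb; apply: limr_ge.
    apply: nondecreasing_at_left_is_cvgr.
    + near=> y => s t; rewrite !in_itv/= => /andP[ys sb] /andP[yt tb] st.
      have xy : x <= y by near: y; apply: nbhs_left_ge.
      by apply: ndG' => //; apply: Iy; rewrite ?lte_fin// ltW// (le_lt_trans xy).
    + near=> y; exists M => _ /= [s + <-]; rewrite in_itv/= => /andP[ys sb].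
      have xy : x <= y by near: y; apply: nbhs_left_ge.
      have sb' : (s%:E < b'%:E)%E by rewrite lte_fin.
      have := bndG' _ (Iy s (ltW (le_lt_trans xy ys)) sb').
      by rewrite ler_norml => /andP[].
  near=> y; have xy : x <= y by near: y; apply: nbhs_left_ge.
  apply: ndG' => //; apply: Iy => //; rewrite lte_fin; near: y; exact: nbhs_left_lt.
(* The convergence theorem at infinity is for functions monotone on the whole line, so [G] is frozen
   to the left of [x]; near infinity nothing changes. *)
- have Imax t : oitv a%:E +oo%E (Num.max t x).
    by apply: Iy; rewrite ?ltry// le_max lexx orbT.
  have ndGx : {homo (fun t => G (Num.max t x)) : s t / s <= t}.
    by move=> s t st; apply: ndG' => //; rewrite ge_max !le_max st lexx orbT.
  have cv := nondecreasing_cvgr ndGx.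
  have ub : has_ubound (range (fun t => G (Num.max t x))).
    exists M => _ [t _ <-]; have := bndG' _ (Imax t).
    by rewrite ler_norml => /andP[].
  have cvG : G t @[t --> +oo] --> sup (range (fun t => G (Num.max t x))).
    apply: cvg_trans (cv ub); apply: near_eq_cvg; near=> t.
    rewrite max_l//; near: t; exact: nbhs_pinfty_ge.
  rewrite (cvg_lim _ cvG)//; apply: ub_le_sup => //.
  by exists x => //; rewrite maxxx.
Unshelve. all: by end_near. Qed.

Lemma le_extend_to_ends (x y : \bar R) : (a%:E < b)%E ->
  (a%:E <= x)%E -> (x <= y)%E -> (y <= b)%E ->
  extend_to_ends a b G x <= extend_to_ends a b G y.
Proof.
move=> ab ax xy yb.
have oitvP z : (a%:E < z)%E -> (z < b)%E -> exists2 z', z = z'%:E & oitv a%:E b z'.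
  case: z => [z| |]// az zb; last by move: zb; case: (b).
  by exists z => //; rewrite /oitv/= az.
have [z abz] : exists z, oitv a%:E b z.
  move: ab; rewrite /oitv/=; case: (b) => [b'| |]//; last first.
    by move=> _; exists (a + 1); rewrite ltry lte_fin ltrDl ltr01.
  by rewrite lte_fin => /midf_lt[am mb]; exists ((a + b') / 2); rewrite !lte_fin am.
have [xa|{}ax] := leP x a%:E.
  have -> : x = a%:E by apply/eqP; rewrite eq_le xa.
  have [ya|ay] := leP y a%:E.
    have -> // : y = a%:E by apply/eqP; rewrite eq_le ya (le_trans ax).
  have [by_|{}yb] := leP b y.
    have -> : y = b by apply/eqP; rewrite eq_le yb.
    exact: le_trans (extend_to_ends_left_le _ abz) (le_extend_to_ends_right _ abz).
  have [y' -> Iy] := oitvP y ay yb.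
  by rewrite [leRHS]extend_to_ends_oitv// extend_to_ends_left_le.
have [bx|xb] := leP b x.
  have -> // : x = y by apply/eqP; rewrite eq_le xy (le_trans yb).
have [x' xE Ix] := oitvP x ax xb.
rewrite [in leLHS]xE extend_to_ends_oitv//.
have [by_|{}yb] := leP b y.
  have -> : y = b by apply/eqP; rewrite eq_le yb.
  exact: le_extend_to_ends_right.
have [y' yE Iy] := oitvP y (lt_le_trans ax xy) yb.
by rewrite yE extend_to_ends_oitv// ndG// -lee_fin -xE -yE.
Qed.

End extension_to_ends.

Section length_estimates.
Variables (R : realType) (r1 : R) (r3 : \bar R) (G : R -> R) (delta gamma cE M : R).
Variable speed : R -> \bar R.
Hypothesis r1_ge0 : 0 <= r1.
Hypothesis delta_gt0 : 0 < delta.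
Hypothesis cE_gt0 : 0 < cE.
Hypothesis gamma01 : 0 <= gamma < 1.
Hypothesis ndG : forall x y, oitv r1%:E r3 x -> oitv r1%:E r3 y -> x <= y -> G x <= G y.
Hypothesis bndG : forall x, oitv r1%:E r3 x -> `|G x| <= M.
Hypothesis odeG : {ae @lebesgue_measure R, forall r, oitv r1%:E r3 r ->
  derivable G r 1 /\ delta / r * `|G r| `^ (1 + gamma) <= derive1 G r}.
Hypothesis speed_ge0 : forall x, oitv r1%:E r3 x -> (0 <= speed x)%E.
Hypothesis speed_le : {ae @lebesgue_measure R, forall x, oitv r1%:E r3 x ->
  (speed x <= (Num.sqrt (derive1 G x / (cE * x)))%:E)%E}.

Local Notation p := ((1 - gamma) / 2).
Local Notation C := ((p * Num.sqrt (cE * delta))^-1).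
Local Notation Gbar := (extend_to_ends r1 r3 G).

Let p_gt0 : 0 < p.
Proof. by case/andP: gamma01 => _ ?; rewrite divr_gt0// subr_gt0. Qed.

Let C_ge0 : 0 <= C.
Proof. by rewrite invr_ge0 mulr_ge0 ?sqrtr_ge0// ltW. Qed.

Lemma length_le (s r : \bar R) (A B : R) :
  (r1%:E <= s)%E -> (r <= r3)%E -> A <= B ->
  (forall x, oitv s r x -> A <= sgpow p (G x) <= B) ->
  (\int[@lebesgue_measure R]_(x in oitv s r) speed x <= (C * (B - A))%:E)%E.
Proof.
move=> r1s rr3 AB GAB; case/andP: (gamma01) => _ gamma1.
have sub : oitv s r `<=` oitv r1%:E r3.
  by move=> x /andP[sx xr]; rewrite /oitv/= (le_lt_trans r1s sx) (lt_le_trans xr).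
apply: (integral_speed_le _ _ _ _ _ _ _ _ _ _ _ _ r1_ge0 delta_gt0 cE_gt0 gamma1 ndG odeG) => //.
by move=> x /sub; exact: speed_ge0.
Qed.

Lemma length_total :
  (\int[@lebesgue_measure R]_(x in oitv r1%:E r3) speed x <=
    (C * ((- Num.min (Gbar r1%:E) 0) `^ p + (Num.max (Gbar r3) 0) `^ p))%:E)%E.
Proof.
have pn0 : p != 0 by rewrite gt_eqF.
(* Truncation at 0 fixes the signs of both end values, and the increment of [sgpow p] becomes a sum
   of two powers. *)
set a := Num.min _ _; set b := Num.max _ _.
have a0 : a <= 0 by rewrite ge_min lexx orbT.
have b0 : 0 <= b by rewrite le_max lexx orbT.
have -> : (- a) `^ p + b `^ p = sgpow p b - sgpow p a.
  by rewrite (sgpow_le0E _ _ a)// (sgpow_ge0E _ _ b)// opprK addrC.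
apply: length_le => //.
  by rewrite le_sgpow// (le_trans a0).
move=> x Ix; rewrite !le_sgpow//.
- by rewrite le_max (le_extend_to_ends_right _ _ _ _ _ ndG bndG).
- by rewrite ge_min (extend_to_ends_left_le _ _ _ _ _ ndG bndG).
Qed.

(** Since [G >= 0] between [s] and [r], the length is at most [C] times any bound for [G x] to the
    power [p] there. The decay estimate from [x] up to [r3] supplies one, and [x < r] makes it
    uniform. *)
Lemma length_above (r2 s r : \bar R) :
  (r1%:E <= r2)%E -> (forall x, (r2 <= x <= r3)%E -> 0 <= Gbar x) ->
  (r2 <= s)%E -> (s <= r)%E -> (r <= r3)%E ->
  (\int[@lebesgue_measure R]_(x in oitv s r) speed x <=
    if (0 < gamma)%R then
      C%:E * epow (epow (Gbar r3)%:E (- gamma)%R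
                   + (delta * gamma)%:E * log_ratio r3 r)
                  ((gamma - 1) / (2 * gamma))%R
    else (C * Gbar r3 `^ 2^-1 * equot r r3 `^ (delta / 2))%:E)%E.
Proof.
move=> r12 Gge0 r2s sr rr3; set U := (X in (_ <= X)%E).
have pn0 : p != 0 by rewrite gt_eqF.
have U0 : (0 <= U)%E.
  rewrite /U; case: ifP => _; first by rewrite mule_ge0 ?lee_fin ?epow_ge0.
  by rewrite lee_fin !mulr_ge0 ?powR_ge0.
have r1s : (r1%:E <= s)%E := le_trans r12 r2s.
have sub x : oitv s r x -> oitv r1%:E r3 x.
  by move=> /andP[sx xr]; rewrite /oitv/= (le_lt_trans r1s sx) (lt_le_trans xr).
have Gx_ge0 x : oitv s r x -> 0 <= G x.
  move=> Ix; have /andP[sx xr] := Ix.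
  rewrite -(extend_to_ends_oitv _ _ _ _ _ (sub x Ix)) Gge0//.
  by rewrite (le_trans r2s (ltW sx)) (le_trans (ltW xr)).
(* If [G] vanishes throughout, the length is 0 and the right side, under any of its conventions at 0
   and infinity, is nonnegative. Otherwise [r3] is finite and the right side is a real number. *)
have [[t0 [It0 Gt0]]|noG] := pselect (exists t, oitv s r t /\ 0 < G t); last first.
  apply: le_trans U0; rewrite -[leRHS]/(0%:E) -[X in X%:E](mulr0 C) -[X in C * X](subrr 0).
  apply: length_le => // x Ix.
  have -> : G x = 0.
    by apply/eqP; rewrite eq_le Gx_ge0// andbT leNgt; apply/negP => Gx; apply: noG; exists x.
  by rewrite /sgpow sgr0 mul0r lexx.
set L := Gbar r3.
have GL x : oitv r1%:E r3 x -> G x <= L by exact: (le_extend_to_ends_right _ _ _ _ _ ndG bndG).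
have L0 : 0 < L by exact: lt_le_trans (GL _ (sub _ It0)).
have /andP[st0 t0r] := It0.
have t00 : 0 < t0 by rewrite -lte_fin (le_lt_trans _ st0)// (le_trans _ r1s)// lee_fin.
suff [B [B0 UB GB]] : exists B, [/\ 0 <= B, U = (C * B)%:E &
    forall x, oitv s r x -> 0 < G x -> G x `^ p <= B].
  rewrite UB -[X in C * X]subr0; apply: length_le => // x Ix.
  rewrite sgpow_ge0 ?Gx_ge0//= sgpow_ge0E ?Gx_ge0//.
  have := Gx_ge0 _ Ix; rewrite le_eqVlt => /predU1P[<-|]; last exact: GB.
  by rewrite powR0.
rewrite /U; case: ifPn => [gamma0|]; last first.
  rewrite -leNgt => gamma0; have {}gamma0 : gamma = 0.
    by apply/eqP; rewrite eq_le gamma0; case/andP: gamma01.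
  exists (L `^ 2^-1 * equot r r3 `^ (delta / 2)); split.
  - by rewrite mulr_ge0 ?powR_ge0.
  - by rewrite mulrA.
  move=> x Ix Gx; have [rho r3E lnrho] := above_bound0 _ _ _ _ _ _ r1_ge0 delta_gt0 ndG odeG x L gamma0 (sub _ Ix) Gx GL.
  have /andP[sx xr] := Ix.
  case: r sr rr3 t0r xr {U U0 sub Gx_ge0 It0 Ix} => [r| |]; [|by rewrite r3E|by rewrite r3E].
  rewrite r3E /equot/= !lee_fin !lte_fin => sr rrho t0r xr.
  have r_gt0 : 0 < r by exact: lt_trans t0r.
  have x_gt0 : 0 < x by rewrite -lte_fin (le_lt_trans _ sx)// (le_trans _ r1s)// lee_fin.
  have rho_gt0 : 0 < rho by exact: lt_le_trans rrho.
  rewrite gamma0 subr0 mul1r; apply: powR_decay0_le => //; first by rewrite divr_gt0.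
  rewrite ln_div ?posrE//.
  have lnxr : ln x <= ln r by rewrite ler_ln ?posrE// ltW.
  have : delta * ln x <= delta * ln r by rewrite ler_pM2l.
  move: lnrho; lra.
have [rho r3E _] := above_bound _ _ _ _ _ _ r1_ge0 delta_gt0 ndG odeG t0 L gamma0 (sub _ It0) Gt0 GL.
have [r' rE] : exists r', r = r'%:E.
  by case: r rr3 t0r {U U0 sub Gx_ge0 It0 sr} => [r _ _| |]; [exists r|rewrite r3E|].
have r'_gt0 : 0 < r' by rewrite -lte_fin -rE (lt_trans _ t0r)// lte_fin.
have r'rho : r' <= rho by rewrite -lee_fin -rE -r3E.
have rho_gt0 : 0 < rho by exact: lt_le_trans r'rho.
set X := L `^ (- gamma) + delta * gamma * (ln rho - ln r').
have X0 : 0 < X.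
  rewrite ltr_pwDl ?powR_gt0// mulr_ge0 ?mulr_ge0 ?(ltW delta_gt0) ?(ltW gamma0)//.
  by rewrite subr_ge0 ler_ln ?posrE.
exists (X `^ ((gamma - 1) / (2 * gamma))); split; first exact: powR_ge0.
- by rewrite -/L r3E rE log_ratio_fin// epow_fin// -EFinM -EFinD epow_fin.
move=> x Ix Gx; have /andP[sx xr] := Ix.
have [rho' + lnrho] := above_bound _ _ _ _ _ _ r1_ge0 delta_gt0 ndG odeG x L gamma0 (sub _ Ix) Gx GL.
rewrite r3E => -[rhoE]; rewrite -{}rhoE in lnrho.
have x_gt0 : 0 < x by rewrite -lte_fin (le_lt_trans _ sx)// (le_trans _ r1s)// lee_fin.
apply: powR_decay_le => //; first by rewrite gamma0; case/andP: gamma01.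
apply: le_trans lnrho; rewrite lerD2l ler_pM2l ?mulr_gt0// lerD2l lerN2.
by rewrite ler_ln ?posrE// ltW// -lte_fin -rE.
Qed.

(** Now [sgpow p (G x)] lies in [[- B, 0]], the decay is measured from [r1], and a negative value of
    [G] makes [r1], hence [s], positive. *)
Lemma length_below (r2 s r : \bar R) :
  (r2 <= r3)%E -> (forall x, (r1%:E <= x <= r2)%E -> Gbar x <= 0) ->
  (r1%:E <= s)%E -> (s <= r)%E -> (r <= r2)%E ->
  (\int[@lebesgue_measure R]_(x in oitv s r) speed x <=
    if (0 < gamma)%R then
      C%:E * epow (epow (- Gbar r1%:E)%R%:E (- gamma)%R
                   + (delta * gamma)%:E * log_ratio s r1%:E)
                  ((gamma - 1) / (2 * gamma))%R
    else (C * (- Gbar r1%:E) `^ 2^-1 * equot r1%:E s `^ (delta / 2))%:E)%E.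
Proof.
move=> r23 Gle0 r1s sr rr2; set U := (X in (_ <= X)%E).
have pn0 : p != 0 by rewrite gt_eqF.
have U0 : (0 <= U)%E.
  rewrite /U; case: ifP => _; first by rewrite mule_ge0 ?lee_fin ?epow_ge0.
  by rewrite lee_fin !mulr_ge0 ?powR_ge0.
have rr3 : (r <= r3)%E := le_trans rr2 r23.
have sub x : oitv s r x -> oitv r1%:E r3 x.
  by move=> /andP[sx xr]; rewrite /oitv/= (le_lt_trans r1s sx) (lt_le_trans xr).
have Gx_le0 x : oitv s r x -> G x <= 0.
  move=> Ix; have /andP[sx xr] := Ix.
  rewrite -(extend_to_ends_oitv _ _ _ _ _ (sub x Ix)) Gle0//.
  by rewrite (le_trans r1s (ltW sx)) (le_trans (ltW xr)).
have [[t0 [It0 Gt0]]|noG] := pselect (exists t, oitv s r t /\ G t < 0); last first.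
  apply: le_trans U0; rewrite -[leRHS]/(0%:E) -[X in X%:E](mulr0 C) -[X in C * X](subrr 0).
  apply: length_le => // x Ix.
  have -> : G x = 0.
    by apply/eqP; rewrite eq_le Gx_le0//= leNgt; apply/negP => Gx; apply: noG; exists x.
  by rewrite /sgpow sgr0 mul0r lexx.
set L := Gbar r1%:E.
have GL x : oitv r1%:E r3 x -> L <= G x by exact: (extend_to_ends_left_le _ _ _ _ _ ndG bndG).
have L0 : 0 < - L by rewrite oppr_gt0 (le_lt_trans (GL _ (sub _ It0))).
have /andP[st0 t0r] := It0.
have [s' sE] : exists s', s = s'%:E.
  by case: s r1s st0 {U U0 sub Gx_le0 It0 sr} => [s _ _| |]; [exists s| |].
have s'_ge : r1 <= s' by rewrite -lee_fin -sE.
suff [B [B0 UB GB]] : exists B, [/\ 0 <= B, U = (C * B)%:E &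
    forall x, oitv s r x -> G x < 0 -> (- G x) `^ p <= B].
  rewrite UB -[B]opprK -[X in C * X]add0r; apply: length_le => //.
    by rewrite oppr_le0.
  move=> x Ix; rewrite sgpow_le0E ?Gx_le0// lerN2 oppr_le0 powR_ge0 andbT.
  have := Gx_le0 _ Ix; rewrite le_eqVlt => /predU1P[->|]; last exact: GB.
  by rewrite oppr0 powR0.
rewrite /U; case: ifPn => [gamma0|]; last first.
  rewrite -leNgt => gamma0; have {}gamma0 : gamma = 0.
    by apply/eqP; rewrite eq_le gamma0; case/andP: gamma01.
  exists ((- L) `^ 2^-1 * equot r1%:E s `^ (delta / 2)); split.
  - by rewrite mulr_ge0 ?powR_ge0.
  - by rewrite mulrA.
  move=> x Ix Gx; have [r1_gt0 lnr1] := below_bound0 _ _ _ _ _ _ r1_ge0 delta_gt0 ndG odeG x L gamma0 (sub _ Ix) Gx GL.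
  have /andP[sx xr] := Ix.
  have s'_gt0 : 0 < s' by exact: lt_le_trans s'_ge.
  have s'x : s' < x by rewrite -lte_fin -sE.
  have x_gt0 : 0 < x by exact: lt_trans s'x.
  rewrite sE /equot/= gamma0 subr0 mul1r; apply: powR_decay0_le => //.
  - by rewrite oppr_gt0.
  - by rewrite divr_gt0.
  rewrite ln_div ?posrE//.
  have lnsx : ln s' <= ln x by rewrite ler_ln ?posrE// ltW.
  have : delta * ln s' <= delta * ln x by rewrite ler_pM2l.
  move: lnr1; lra.
have [r1_gt0 _] := below_bound _ _ _ _ _ _ r1_ge0 delta_gt0 ndG odeG t0 L gamma0 (sub _ It0) Gt0 GL.
have s'_gt0 : 0 < s' by exact: lt_le_trans s'_ge.
set X := (- L) `^ (- gamma) + delta * gamma * (ln s' - ln r1).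
have X0 : 0 < X.
  rewrite ltr_pwDl ?powR_gt0// mulr_ge0 ?mulr_ge0 ?(ltW delta_gt0) ?(ltW gamma0)//.
  by rewrite subr_ge0 ler_ln ?posrE.
exists (X `^ ((gamma - 1) / (2 * gamma))); split; first exact: powR_ge0.
- by rewrite -/L sE log_ratio_fin// epow_fin// -EFinM -EFinD epow_fin.
move=> x Ix Gx; have /andP[sx xr] := Ix.
have [_ lnr1] := below_bound _ _ _ _ _ _ r1_ge0 delta_gt0 ndG odeG x L gamma0 (sub _ Ix) Gx GL.
have s'x : s' < x by rewrite -lte_fin -sE.
apply: powR_decay_le => //; [by rewrite gamma0; case/andP: gamma01|by rewrite oppr_gt0|].
apply: le_trans lnr1; rewrite lerD2l ler_pM2l ?mulr_gt0// lerD2r.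
by rewrite ler_ln ?posrE// ?ltW// (lt_trans s'_gt0).
Qed.

End length_estimates.

(** * From the hypotheses on the energy to the differential inequality for [G] *)

(** The default value 0 of [energy] off H^1(B_1) lies in [-1, 1] too. *)
Lemma energy_bounds (R : realType) (n : nat) (E : H1_unit R n -> R) (v : 'rV[R]_n -> R) :
  (forall w, -1 <= E w <= 1) -> -1 <= energy E v <= 1.
Proof. by move=> E1; rewrite /energy; case: pselect => // _; rewrite lerN10 ler01. Qed.

Lemma error_le1 (R : realType) (alpha r1 Lp Lm x : R) (r3 : \bar R) :
  0 < alpha -> 0 <= r1 -> 0 <= Lp -> 0 <= Lm ->
  (r1 = 0 -> Lm = 0) -> (r3 = +oo%E -> Lp = 0) ->
  (Order.max (Lp%:E * r3 `^ alpha) (Lm * r1 `^ (- alpha))%:E <= 1)%E ->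
  oitv r1%:E r3 x ->
  0 <= Lp * x `^ alpha <= 1 /\ 0 <= Lm * x `^ (- alpha) <= 1.
Proof.
move=> a0 r10 Lp0 Lm0 Lm_r1 Lp_r3; rewrite ge_max => /andP[Lp1 Lm1] /andP[r1x xr3].
rewrite lte_fin in r1x; rewrite lee_fin in Lm1.
have x0 : 0 < x by exact: le_lt_trans r1x.
split; apply/andP; split; rewrite ?mulr_ge0 ?powR_ge0//.
- case: r3 Lp_r3 Lp1 xr3 => [rho| |]//; last by move=> ->//; rewrite mul0r.
  rewrite poweR_EFin -EFinM !lte_fin !lee_fin => _ + xrho; apply: le_trans.
  rewrite ler_wpM2l// ge0_ler_powR ?nnegrE ?(ltW a0) ?(ltW x0) ?(ltW xrho)//.
  by rewrite ltW// (lt_trans x0).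
(* At [r1 = 0] the power of 0 with negative exponent is 0, so the bound there is void and the
   convention [Lm = 0] takes over. *)
- have [r1E|r1n0] := eqVneq r1 0; first by rewrite Lm_r1// mul0r.
  have r1_gt0 : 0 < r1 by rewrite lt_neqAle eq_sym r1n0.
  apply: le_trans Lm1; rewrite ler_wpM2l// !powRN lef_pV2 ?posrE ?powR_gt0//.
  by rewrite ge0_ler_powR ?nnegrE ?(ltW a0) ?(ltW r1x) ?(ltW x0).
Qed.

Lemma powRB1 (R : realType) (x p : R) : 0 < x -> x `^ (p - 1) = x `^ p / x.
Proof. by move=> x0; rewrite powRB ?powRr1 ?(ltW x0)// (gt_eqF x0) implybT. Qed.

(** Multiplication by [x] makes every term scale-invariant and reduces the claim to [rate_le] with
    [X = x * g']. *)
Lemma energy_inequality (R : realType) (cE eps gamma alpha x e ez Lp Lm e' g' : R)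
    (D : \bar R) :
  0 < cE <= 1 -> 0 < eps <= 1 -> 0 <= gamma < 1 -> 0 < alpha <= 1 -> 0 < x ->
  -1 <= e <= 1 -> -1 <= ez <= 1 ->
  0 <= Lp * x `^ alpha <= 1 -> 0 <= Lm * x `^ (- alpha) <= 1 -> (0 <= D)%E ->
  ((cE / x * (ez - e))%:E + (cE / x)%:E * D - (Lp * x `^ (alpha - 1))%:E
    - (Lm * x `^ (- alpha - 1))%:E <= e'%:E)%E ->
  e <= ez - eps * `|ez| `^ (1 + gamma) + Lp * x `^ alpha + Lm * x `^ (- alpha) ->
  g' = e' + (3 * Lp * x `^ (alpha - 1) + 3 * Lm * x `^ (- alpha - 1)) ->
  (D <= (x * g' / cE)%:E)%E /\
  rate cE eps alpha / x *
    `|e + 3 * alpha^-1 * Lp * x `^ alpha - 3 * alpha^-1 * Lm * x `^ (- alpha)|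
      `^ (1 + gamma) <= g'.
Proof.
move=> cE01 eps01 gamma01 alpha01 x0 e1 ez1 Ap Am D0.
have [cE0 _] := andP cE01; have [a0 _] := andP alpha01.
(* An infinite [D] would make the lower bound for the real number [e'] infinite. *)
case: D D0 => [D| |]// D0; last first.
  by rewrite gt0_muley ?lte_fin ?divr_gt0//= leye_eq.
rewrite -EFinM -!EFinD !lee_fin !powRB1// => He' He g'E.
rewrite lee_fin in D0.
have xE : x * g' = x * e' + 3 * (Lp * x `^ alpha) + 3 * (Lm * x `^ (- alpha)).
  by rewrite g'E; field; rewrite gt_eqF.
have xHe' : cE * (ez - e) + cE * D - Lp * x `^ alpha - Lm * x `^ (- alpha) <= x * e'.
  move: He'; rewrite -(ler_pM2l x0); apply: le_trans; rewrite le_eqVlt; apply/orP; left.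
  by apply/eqP; field; rewrite gt_eqF.
have [] := @rate_le R cE eps gamma alpha e ez
  (Lp * x `^ alpha + Lm * x `^ (- alpha)) D (x * g')
  (e + 3 * alpha^-1 * Lp * x `^ alpha - 3 * alpha^-1 * Lm * x `^ (- alpha))
  cE01 eps01 gamma01 alpha01 e1 ez1 => //.
- by move: Ap Am; lra.
- by move: Ap Am; lra.
- by move: He; lra.
- rewrite (_ : _ - e = 3 / alpha * (Lp * x `^ alpha - Lm * x `^ (- alpha))); last by ring.
  rewrite normrM ger0_norm ?divr_ge0 ?(ltW a0)// ler_wpM2l ?divr_ge0 ?(ltW a0)//.
  by rewrite ler_norml; move: Ap Am; lra.
move=> H1 H2; split; first by rewrite ler_pdivlMr// mulrC.
by rewrite mulrAC ler_pdivrMr// [g' * x]mulrC.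
Qed.

Theorem theorem2p2 (R : realType) (cE eps gamma alpha : R)
    (hcE : 0 < cE <= 1) (heps : 0 < eps <= 1)
    (hgamma : 0 <= gamma < 1) (halpha : 0 < alpha <= 1) :
  exists delta c : R, 0 < delta /\
  forall (n : nat) (m r1 : R) (r3 : \bar R) (Lp Lm : R)
    (u : 'rV[R]_n -> R) (dru : R -> 'rV[R]_n -> R) (E : H1_unit R n -> R),
  (0 < n)%N ->
  2 - n%:R < m ->
  0 <= r1 ->
  (r1%:E < r3)%E ->
  (if r3 is rho%:E then H1 (@eball R n rho) u
   else forall rho : R, 0 < rho -> H1 (@eball R n rho) u) ->
  radial_derivative m r3 u dru ->
  0 <= Lp ->
  0 <= Lm ->
  (r1 = 0 -> Lm = 0) ->
  (r3 = +oo%E -> Lp = 0) ->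
  (forall v, -1 <= E v <= 1) ->
  ae_invariant E ->
  BV_loc r1%:E r3 (fun r => energy E (rescale m u r)) ->
  BV_derivative_ge r1%:E r3 (fun r => energy E (rescale m u r))
    (fun r =>
       ((cE / r * (energy E (homog_ext m u r) - energy E (rescale m u r)))%:E
        + (cE / r)%:E
          * \int[@surface R n]_(th in @unit_sphere R n)
              (r ^+ 2 * `|dru r th| ^+ 2)%:E
        - (Lp * r `^ (alpha - 1))%:E
        - (Lm * r `^ (- alpha - 1))%:E)%E) ->
  {ae @lebesgue_measure R, forall r, oitv r1%:E r3 r ->
     energy E (rescale m u r) <=
       energy E (homog_ext m u r)
       - eps * `|energy E (homog_ext m u r)| `^ (1 + gamma)
       + Lp * r `^ alpha + Lm * r `^ (- alpha)} ->
  (Order.max (Lp%:E * r3 `^ alpha) (Lm * r1 `^ (- alpha))%:E <= 1)%E ->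
  let G0 := fun r : R =>
    energy E (rescale m u r)
    + 3 * alpha^-1 * Lp * r `^ alpha - 3 * alpha^-1 * Lm * r `^ (- alpha) in
  let G := extend_to_ends r1 r3 G0 in
  let path_length := fun s r : \bar R =>
    (\int[@lebesgue_measure R]_(t in oitv s r) L2_sphere (dru t))%E in
  [/\
      (forall x y, (r1%:E <= x)%E -> (x <= y)%E -> (y <= r3)%E -> G x <= G y)
      /\ {ae @lebesgue_measure R, forall r, oitv r1%:E r3 r ->
            derivable G0 r 1 /\
            delta / r * `|G0 r| `^ (1 + gamma) <= derive1 G0 r},
      (\int[@lebesgue_measure R]_(r in oitv r1%:E r3)
         (L2_sphere (fun th => (r * dru r th)%R) * (r^-1)%:E)
       <= (c * ((- Num.min (G r1%:E) 0) `^ ((1 - gamma) / 2)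
                + (Num.max (G r3) 0) `^ ((1 - gamma) / 2)))%:E)%E
    &
      forall r2 : \bar R, (r1%:E <= r2 <= r3)%E ->
        (forall x, (r1%:E <= x <= r2)%E -> G x <= 0) ->
        (forall x, (r2 <= x <= r3)%E -> 0 <= G x) ->
        (forall s r, (r2 <= s)%E -> (s <= r)%E -> (r <= r3)%E ->
           (path_length s r <=
              if (0 < gamma)%R then
                c%:E * epow (epow (G r3)%:E (- gamma)%R
                             + (delta * gamma)%:E * log_ratio r3 r)
                            ((gamma - 1) / (2 * gamma))%R
              else
                (c * G r3 `^ 2^-1 * equot r r3 `^ (delta / 2))%:E)%E)
        /\
        (forall s r, (r1%:E <= s)%E -> (s <= r)%E -> (r <= r2)%E ->
           (path_length s r <=
              if (0 < gamma)%R then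
                c%:E * epow (epow (- G r1%:E)%R%:E (- gamma)%R
                             + (delta * gamma)%:E * log_ratio s r1%:E)
                            ((gamma - 1) / (2 * gamma))%R
              else
                (c * (- G r1%:E) `^ 2^-1 * equot r1%:E s `^ (delta / 2))%:E)%E)].
Proof.
have [cE0 cE1] := andP hcE; have [eps0 _] := andP heps.
have [gamma0 gamma1] := andP hgamma; have [a0 _] := andP halpha.
have delta0 := rate_gt0 R cE eps alpha cE0 eps0 a0.
exists (rate cE eps alpha),
  (((1 - gamma) / 2 * Num.sqrt (cE * rate cE eps alpha))^-1); split=> //.
move=> n m r1 r3 Lp Lm u dru E n0 _ r10 r13 _ _ Lp0 Lm0 Lm_r1 Lp_r3 E1 _ _
  [de inte] Ez err1 G0 G path_length.
pose e r := energy E (rescale m u r).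
pose ez r := energy E (homog_ext m u r).
pose err r := 3 * alpha^-1 * Lp * r `^ alpha - 3 * alpha^-1 * Lm * r `^ (- alpha).
pose err' r := 3 * Lp * r `^ (alpha - 1) + 3 * Lm * r `^ (- alpha - 1).
pose D r := (\int[@surface R n]_(th in @unit_sphere R n) (r ^+ 2 * `|dru r th| ^+ 2)%:E)%E.
have G0E : G0 = e \+ err by apply/funext => r; rewrite /G0/= /err addrA.
have x_gt0 x : oitv r1%:E r3 x -> 0 < x.
  by move=> /andP[+ _]; rewrite lte_fin; exact: le_lt_trans.
have errle x : oitv r1%:E r3 x ->
    0 <= Lp * x `^ alpha <= 1 /\ 0 <= Lm * x `^ (- alpha) <= 1.
  exact: error_le1.
have derr x : oitv r1%:E r3 x -> is_derive x 1 err (err' x).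
  by move=> /x_gt0 x0; exact: is_derive_error.
have ode : {ae @lebesgue_measure R, forall x, oitv r1%:E r3 x ->
    [/\ derivable G0 x 1, rate cE eps alpha / x * `|G0 x| `^ (1 + gamma) <= derive1 G0 x,
        - err' x <= derive1 e x & (D x <= (x * derive1 G0 x / cE)%:E)%E]}.
  apply: (ae_lebesgueW2 _ _ _ _ _ de Ez) => x dex Ezx Ix.
  have [dex1 dex2] := dex Ix.
  have x0 := x_gt0 x Ix.
  have dG := is_deriveD (derivableP dex1) (derr x Ix).
  rewrite -/e in dG dex1 dex2.
  have g'E : derive1 G0 x = derive1 e x + err' x.
    by rewrite G0E !derive1E (@derive_val _ _ _ _ _ _ _ dG).
  have dG0 : derivable G0 x 1 by rewrite G0E; exact: (@ex_derive _ _ _ _ _ _ _ dG).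
  have D0 : (0 <= D x)%E.
    apply: integral_setfun_ge0; first exact: hausdorff_measure0.
    by move=> th _; rewrite lee_fin mulr_ge0 ?sqr_ge0.
  have [Ap Am] := errle x Ix.
  have [DX rateX] := energy_inequality R cE eps gamma alpha x (e x) (ez x) Lp Lm
    (derive1 e x) (derive1 G0 x) (D x) hcE heps hgamma halpha x0
    (energy_bounds _ _ _ _ E1) (energy_bounds _ _ _ _ E1) Ap Am D0 dex2 (Ezx Ix) g'E.
  split=> //.
  (* The lower bound on the derivative of [e] says that the derivative of [G0] is nonnegative, which
     the rate estimate contains. *)
  rewrite -subr_ge0 opprK -g'E; apply: le_trans rateX.
  by rewrite mulr_ge0 ?powR_ge0// divr_ge0// ltW.
(* The integral inequality [inte] controls the singular part of the energy, which the pointwise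
   derivative does not see. *)
have ndG : forall x y, oitv r1%:E r3 x -> oitv r1%:E r3 y -> x <= y -> G0 x <= G0 y.
  rewrite G0E.
  apply: (@nondecreasing_of_integral_derive1_le R r1%:E r3 e err' err inte).
    by apply: ae_lebesgueW ode => x odex Ix; have [] := odex Ix.
  move=> x Ix; have x0 := x_gt0 x Ix; split.
  - by rewrite addr_ge0// !mulr_ge0 ?powR_ge0.
  - exact: derr.
  - apply: cvgD; apply: cvgM; try exact: cvg_cst; exact: continuous_powR.
have bndG x : oitv r1%:E r3 x -> `|G0 x| <= 1 + 3 / alpha.
  move=> Ix; have [Ap Am] := errle x Ix.
  have ex1 := energy_bounds _ _ _ (rescale m u x) E1.
  have -> : G0 x = e x + 3 / alpha * (Lp * x `^ alpha - Lm * x `^ (- alpha)).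
    by rewrite /G0 -/(e x); ring.
  rewrite (le_trans (ler_normD _ _))// lerD//; first by rewrite ler_norml.
  rewrite normrM ger0_norm ?divr_ge0 ?(ltW a0)// ler_piMr ?divr_ge0 ?(ltW a0)//.
  by rewrite ler_norml; move: Ap Am; lra.
have odeG : {ae @lebesgue_measure R, forall x, oitv r1%:E r3 x ->
    derivable G0 x 1 /\ rate cE eps alpha / x * `|G0 x| `^ (1 + gamma) <= derive1 G0 x}.
  by apply: ae_lebesgueW ode => x odex Ix; have [] := odex Ix.
(* The Dini integrand and the speed of the path obey the same bound, with the square root of
   [derive1 G0 x / (cE * x)], so the length estimates apply to both. *)
have sqE x : 0 < x -> x^-1 * Num.sqrt (x * derive1 G0 x / cE) =
    Num.sqrt (derive1 G0 x / (cE * x)).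
  move=> x0.
  have -> : derive1 G0 x / (cE * x) = x^-1 ^+ 2 * (x * derive1 G0 x / cE).
    by field; rewrite !gt_eqF.
  by rewrite [in RHS]sqrtrM ?sqr_ge0// sqrtr_sqr ger0_norm// invr_ge0 ltW.
have G'0 x : 0 < x ->
    rate cE eps alpha / x * `|G0 x| `^ (1 + gamma) <= derive1 G0 x ->
    0 <= x * derive1 G0 x / cE.
  move=> x0 rateX; rewrite divr_ge0 ?(ltW cE0)// mulr_ge0 ?(ltW x0)//.
  by apply: le_trans rateX; rewrite mulr_ge0 ?powR_ge0// divr_ge0// ltW.
have speed2 : {ae @lebesgue_measure R, forall x, oitv r1%:E r3 x ->
    (L2_sphere (fun th => (x * dru x th)%R) * (x^-1)%:E <=
      (Num.sqrt (derive1 G0 x / (cE * x)))%:E)%E}.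
  apply: ae_lebesgueW ode => x odex Ix; have [_ rateX _ DX] := odex Ix.
  have x0 := x_gt0 x Ix.
  rewrite -sqE// EFinM muleC lee_wpmul2l ?lee_fin ?invr_ge0 ?(ltW x0)//.
  by apply: L2_sphereM_le => //; exact: G'0.
have speed3 : {ae @lebesgue_measure R, forall x, oitv r1%:E r3 x ->
    (L2_sphere (dru x) <= (Num.sqrt (derive1 G0 x / (cE * x)))%:E)%E}.
  apply: ae_lebesgueW ode => x odex Ix; have [_ rateX _ DX] := odex Ix.
  have x0 := x_gt0 x Ix.
  by rewrite -sqE//; apply: L2_sphere_le => //; exact: G'0.
split.
- split=> // x y r1x xy yr3.
  exact: (le_extend_to_ends _ _ _ _ _ ndG bndG).
- apply: (length_total _ _ _ _ _ _ _ _ _ r10 delta0 cE0 hgamma ndG bndG odeG _ speed2) => x Ix.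
  by rewrite mule_ge0 ?L2_sphere_ge0// lee_fin invr_ge0 ltW// x_gt0.
- have speed0 x : oitv r1%:E r3 x -> (0 <= L2_sphere (dru x))%E.
    by move=> _; exact: L2_sphere_ge0.
  move=> r2 /andP[r12 r23] Gle0 Gge0; split=> s r.
  + exact: (length_above _ _ _ _ _ _ _ _ _ r10 delta0 cE0 hgamma ndG bndG odeG speed0 speed3).
  + exact: (length_below _ _ _ _ _ _ _ _ _ r10 delta0 cE0 hgamma ndG bndG odeG speed0 speed3).
Qed.
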